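(* Let $\mathcal{M}=(\mathbb{R}^+\times\mathbb{R},\nabla)$ be a Type $\mathcal{B}$ surface model with $\rho_s\neq0$ which is not also of Type $\mathcal{A}$, i.e. with $(C_{12}{}^1,C_{22}{}^1,C_{22}{}^2)\neq(0,0,0)$ (equivalently $\dim\{\mathfrak{K}(\mathcal{M})\}\le3$). Let $\mu\in\mathbb{R}\setminus\{0,-1\}$. Then $\dim\{E(\mu,\nabla)\}\geq1$ if and only if, up to linear equivalence, $\mathcal{M}$ is of the form (one sign $\pm$ being fixed throughout) $$C_{22}{}^1=\pm1,\quad C_{12}{}^1=0,\quad C_{22}{}^2=\pm2C_{11}{}^2,\quad \Delta:=-C_{11}{}^1+C_{12}{}^2+1\neq0,$$ $$\mu=\Delta^{-2}\{1\pm2(C_{11}{}^2)^2-(C_{11}{}^1-C_{12}{}^2)^2+2C_{12}{}^2\}.$$ In this case $\operatorname{Span}\{(x^1)^{\mu\Delta}\}\subset E(\mu,\nabla)$ and, with $\tilde\rho=(x^1)^2\rho$, $$\tilde\rho=\begin{pmatrix}\pm2(C_{11}{}^2)^2+(C_{11}{}^1-C_{12}{}^2+1)C_{12}{}^2 & \pm C_{11}{}^2\\ \mp C_{11}{}^2 & \pm(C_{11}{}^1-C_{12}{}^2-1)\end{pmatrix}.$$ Moreover, (for a surface of this form with this $\mu\notin\{0,-1\}$) $\dim\{E(\mu,\nabla)\}=2$ if and only if, up to linear equivalence, one of the following holds: (1) $C_{11}{}^1=\mp8c^2-\frac52$, $C_{11}{}^2=c$, $C_{12}{}^1=0$, $C_{12}{}^2=\frac12(\mp8c^2-3)$,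 $C_{22}{}^1=\pm1$, $C_{22}{}^2=\pm2c$, with $c\neq0$. In this case $\mu=-\frac{\pm8c^2+3}{\pm8c^2+4}$ and $E(\mu,\nabla)=(x^1)^\alpha\operatorname{Span}\{1,\ x^2-2cx^1\}$, where $\alpha=\mp4c^2-\frac32$. Moreover $\tilde\rho=\begin{pmatrix}8(2c^4\pm c^2)&\pm c\\ \mp c&-4c^2\mp2\end{pmatrix}$. (2) $C_{11}{}^1=c$, $C_{11}{}^2=0$, $C_{12}{}^1=0$, $C_{12}{}^2=c+1$, $C_{22}{}^1=\pm1$, $C_{22}{}^2=0$, with $c\notin\{-3,-1\}$. In this case $\mu=\frac{c+1}{2}$ and $E(\mu,\nabla)=(x^1)^{1+c}\operatorname{Span}\{1,\ x^2\}$. Moreover $\tilde\rho=\mp2\,dx^2\otimes dx^2$.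
   Context: For a torsion free connection $\nabla$ on a surface, with $\nabla_{\partial_{x^i}}\partial_{x^j}=\Gamma_{ij}{}^k\partial_{x^k}$, put $R(X,Y)=[\nabla_X,\nabla_Y]-\nabla_{[X,Y]}$, $\rho(X,Y)=\operatorname{Tr}\{Z\mapsto R(Z,X)Y\}$, $\rho_{ij}=\rho(\partial_{x^i},\partial_{x^j})$ ($\rho$ need not be symmetric; the matrices list $\tilde\rho_{ij}$ with row $i$, column $j$), and let $\rho_s$ be the symmetrization of $\rho$. The Hessian is $\mathcal{H}f=(\partial_{x^i}\partial_{x^j}f-\Gamma_{ij}{}^k\partial_{x^k}f)\,dx^i\otimes dx^j$, and for $\mu\in\mathbb{R}$, $E(\mu,\nabla)=\{f\in C^\infty: \mathcal{H}f=\mu f\rho_s\}$. $\mathfrak{K}(\mathcal{M})$ is the Lie algebra of affine Killing vector fields, i.e. vector fields $X$ with $\mathcal{L}_X\nabla=0$. A Type $\mathcal{B}$ surface model is $\mathbb{R}^+\times\mathbb{R}$ (coordinates $x^1>0$, $x^2$) with Christoffel symbols $\Gamma_{ij}{}^k=(x^1)^{-1}C_{ij}{}^k$, $C_{ij}{}^k=C_{ji}{}^k$ real constants. Two such models are linearly equivalent (isomorphic) if some map $(x^1,x^2)\mapsto(x^1,a\,x^1+b\,x^2)$ with $b\neq0$ intertwines the connections. A non-flat Type $\mathcal{B}$ surface is also of Type $\mathcal{A}$ (constant Christoffel symbols in some local coordinates) if and only if $(C_{12}{}^1,C_{22}{}^1,C_{22}{}^2)=(0,0,0)$. The notation $g\operatorname{Span}\{h_1,\dots\}$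 means $\operatorname{Span}\{gh_1,\dots\}$. *)

(* Defs.v *)
From Stdlib Require Import Reals List.
From Coquelicot Require Import Coquelicot.
Import ListNotations.
Open Scope R_scope.

(** The underlying manifold is the half plane [x1 > 0].  Scalar functions are
    total functions of the two coordinates, but only their values on the half
    plane matter: every condition below is imposed at points with [0 < x]
    only, and equality of functions is [eq_on]. *)

Inductive idx := I1 | I2.

Definition sum2 (f : idx -> R) : R := f I1 + f I2.

Definition sfun := R -> R -> R.
Definition vfield := idx -> sfun.

Definition pd (i : idx) (f : sfun) : sfun :=
  match i with
  | I1 => fun x y => Derive (fun t => f t y) x
  | I2 => fun x y => Derive (fun t => f x t) y
  end.

Fixpoint iter_pd (w : list idx) (f : sfun) : sfun :=
  match w with
  | [] => f
  | i :: w' => pd i (iter_pd w' f)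
  end.

(** [Derive] is total, so the existence of each partial derivative is
    required explicitly. *)
Definition smooth (f : sfun) : Prop :=
  forall (w : list idx) (x y : R), 0 < x ->
    continuity_2d_pt (iter_pd w f) x y
    /\ ex_derive (fun t => iter_pd w f t y) x
    /\ ex_derive (fun t => iter_pd w f x t) y.

Definition smooth_vf (X : vfield) : Prop := forall k, smooth (X k).

Definition eq_on (f g : sfun) : Prop := forall x y, 0 < x -> f x y = g x y.

(** Real vector spaces of functions on the half plane. *)

Fixpoint lincomb (ks : list R) (fs : list sfun) : sfun :=
  match ks, fs with
  | k :: ks', f :: fs' => fun x y => k * f x y + lincomb ks' fs' x y
  | _, _ => fun _ _ => 0
  end.

Definition span (fs : list sfun) (f : sfun) : Prop :=
  exists ks, length ks = length fs /\ eq_on f (lincomb ks fs).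

Definition lin_indep (fs : list sfun) : Prop :=
  forall ks, length ks = length fs ->
    eq_on (lincomb ks fs) (fun _ _ => 0) -> List.Forall (fun k => k = 0) ks.

Definition dim_ge (V : sfun -> Prop) (n : nat) : Prop :=
  exists fs, length fs = n /\ List.Forall V fs /\ lin_indep fs.

Definition dim_eq (V : sfun -> Prop) (n : nat) : Prop :=
  exists fs, length fs = n /\ List.Forall V fs /\ lin_indep fs
    /\ forall f, V f -> span fs f.

Definition smul_span (g : sfun) (hs : list sfun) : sfun -> Prop :=
  span (map (fun (h : sfun) x y => g x y * h x y) hs).

(** [G i j k] is the Christoffel symbol with lower indices [i], [j] and upper
    index [k]. *)
Definition christoffel := idx -> idx -> idx -> sfun.

Definition nabla (G : christoffel) (X Y : vfield) : vfield :=
  fun k x y =>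
    sum2 (fun i => X i x y *
      (pd i (Y k) x y + sum2 (fun j => G i j k x y * Y j x y))).

Definition bracket (X Y : vfield) : vfield :=
  fun k x y =>
    sum2 (fun i => X i x y * pd i (Y k) x y - Y i x y * pd i (X k) x y).

Definition curv (G : christoffel) (X Y Z : vfield) : vfield :=
  fun k x y =>
    nabla G X (nabla G Y Z) k x y - nabla G Y (nabla G X Z) k x y
    - nabla G (bracket X Y) Z k x y.

Definition frame (i : idx) : vfield :=
  fun k _ _ => match i, k with I1, I1 | I2, I2 => 1 | _, _ => 0 end.

(** The trace of [Z |-> R(Z,X)Y], computed in the coordinate frame. *)
Definition ricci (G : christoffel) (X Y : vfield) : sfun :=
  fun x y => sum2 (fun k => curv G (frame k) X Y k x y).

Definition rho (G : christoffel) (i j : idx) : sfun :=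
  ricci G (frame i) (frame j).

Definition rho_s (G : christoffel) (i j : idx) : sfun :=
  fun x y => (rho G i j x y + rho G j i x y) / 2.

Definition hess (G : christoffel) (f : sfun) (i j : idx) : sfun :=
  fun x y => pd i (pd j f) x y - sum2 (fun k => G i j k x y * pd k f x y).

Definition E (mu : R) (G : christoffel) (f : sfun) : Prop :=
  smooth f /\
  forall i j x y, 0 < x -> hess G f i j x y = mu * f x y * rho_s G i j x y.

Record typeB := TypeB {
  coef : idx -> idx -> idx -> R;
  coef_sym : forall i j k, coef i j k = coef j i k
}.

Definition conn (M : typeB) : christoffel :=
  fun i j k x _ => / x * coef M i j k.

(** Push-forward of a vector field along [(x, y) |-> (x, a x + b y)]; the
    preimage of [(u, v)] is [(u, (v - a u) / b)]. *)
Definition push (a b : R) (X : vfield) : vfield :=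
  fun k u v =>
    let w := (v - a * u) / b in
    match k with
    | I1 => X I1 u w
    | I2 => a * X I1 u w + b * X I2 u w
    end.

Definition lin_equiv (M N : typeB) : Prop :=
  exists a b, b <> 0 /\
    forall X Y, smooth_vf X -> smooth_vf Y ->
    forall k, eq_on (push a b (nabla (conn M) X Y) k)
                    (nabla (conn N) (push a b X) (push a b Y) k).

Definition rho_tilde (M : typeB) (i j : idx) : sfun :=
  fun x y => x ^ 2 * rho (conn M) i j x y.

(** [rho_tilde M] is the constant matrix with rows [(a11, a12)] and
    [(a21, a22)]. *)
Definition rho_tilde_is (M : typeB) (a11 a12 a21 a22 : R) : Prop :=
  eq_on (rho_tilde M I1 I1) (fun _ _ => a11)
  /\ eq_on (rho_tilde M I1 I2) (fun _ _ => a12)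
  /\ eq_on (rho_tilde M I2 I1) (fun _ _ => a21)
  /\ eq_on (rho_tilde M I2 I2) (fun _ _ => a22).

Definition DeltaB (M : typeB) : R := - coef M I1 I1 I1 + coef M I1 I2 I2 + 1.

(** In what follows [s] is the sign, [1] or [-1], written as plus-or-minus on
    paper. *)
Definition normal_form (s mu : R) (M : typeB) : Prop :=
  coef M I2 I2 I1 = s
  /\ coef M I1 I2 I1 = 0
  /\ coef M I2 I2 I2 = s * 2 * coef M I1 I1 I2
  /\ DeltaB M <> 0
  /\ mu = / (DeltaB M) ^ 2 *
          (1 + s * 2 * (coef M I1 I1 I2) ^ 2
           - (coef M I1 I1 I1 - coef M I1 I2 I2) ^ 2
           + 2 * coef M I1 I2 I2).

Definition family1 (s c : R) (M : typeB) : Prop :=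
  coef M I1 I1 I1 = - s * 8 * c ^ 2 - 5 / 2
  /\ coef M I1 I1 I2 = c
  /\ coef M I1 I2 I1 = 0
  /\ coef M I1 I2 I2 = / 2 * (- s * 8 * c ^ 2 - 3)
  /\ coef M I2 I2 I1 = s
  /\ coef M I2 I2 I2 = s * 2 * c
  /\ c <> 0.

Definition family2 (s c : R) (M : typeB) : Prop :=
  coef M I1 I1 I1 = c
  /\ coef M I1 I1 I2 = 0
  /\ coef M I1 I2 I1 = 0
  /\ coef M I1 I2 I2 = c + 1
  /\ coef M I2 I2 I1 = s
  /\ coef M I2 I2 I2 = 0
  /\ c <> - 3
  /\ c <> - 1.

(* Main.v *)
Require Import Defs.
From Stdlib Require Import Reals List Lra Classical FunctionalExtensionality.
From Coquelicot Require Import Coquelicot.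
Import ListNotations.
Open Scope R_scope.

(** Write [a, b] for [C_11^1, C_11^2], [c, d] for [C_12^1, C_12^2] and [e, f]
    for [C_22^1, C_22^2].  The equation [H u = mu u rho_s] is a closed
    first-order system for the scaled jet [(u, x u_1, x u_2)]: the operators
    [x d/dx] and [x d/dy] act on it by constant 3 by 3 matrices, here [jetX]
    and [jetY].  The commutation [[x d/dx, x d/dy] = x d/dy] of these
    operators becomes a commutator relation of the matrices, valid on the
    linear hull of the jets of any one solution.  This turns the problem into
    linear algebra.

    The commutator relation forces [jetY] to be nilpotent on the hull: if a
    cubic polynomial in [jetY] vanishes there, so does the one obtained from it
    by the Euler operator [t d/dt], and three applications of the latter to the
    characteristic polynomial isolate [jetY^3].  Hence a nonzero solution
    yields a nonzero vector killed by [jetY], the jet of a would-be solution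
    depending on [x] alone ([translation_invariant_jet]).  If [e = 0] the
    equations for this vector contradict the hypotheses
    ([no_solution_when_C221_zero]).  If [e <> 0], a shear [y -> A x + B y]
    makes [e = s] a sign and [c = 0]; then [rho_s] being nonzero, the same
    equations are exactly the normal form, with exponent [mu Delta]
    ([normal_form_of_solution]).

    In normal form one more use of the commutator relation gives a first-order
    equation [x u_1 = mu Delta u - kappa x u_2] for every solution; here
    [mu <> -1] enters.  Together with nilpotency it shows that every solution
    is [x^(mu Delta) (k0 + k2 (y - 2 b x))], and that [k2 <> 0] requires
    [d = mu Delta] and [b (1 - 2 a + 4 d) = 0]
    ([normal_form_structure]).  Inserting the value of [mu], the case [b <> 0]
    gives the first family; for [b = 0] the remaining equation factors as
    [(d - a - 1) (2 d + 1 - a) = 0], the first factor being the second family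
    and the second factor leading to [mu = -1].

    Two facts connect this to an arbitrary representative of the isomorphism
    class: shears carry solutions to solutions ([E_shear]), and two equivalent
    models with the same sign [e = s] and [c = 0] differ only by the sign of
    [(b, f)], so that they satisfy the normal form for the same [mu]
    ([normal_form_transport]). *)

(** * Smooth functions on the half plane *)

Lemma locally_pos x : 0 < x -> locally x (fun t => 0 < t).
Proof. intros Hx. apply (open_gt 0 x Hx). Qed.

Lemma locally_2d_half_plane (P : R -> R -> Prop) x y :
  0 < x -> (forall u v, 0 < u -> P u v) -> locally_2d P x y.
Proof.
  intros Hx HP. exists (mkposreal x Hx). intros u v Hu _. apply HP.
  apply Rabs_def2 in Hu; simpl in Hu; lra.
Qed.

Lemma eq_on_sym f g : eq_on f g -> eq_on g f.
Proof. intros H x y Hx; symmetry; apply H, Hx. Qed.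

Lemma eq_on_trans f g h : eq_on f g -> eq_on g h -> eq_on f h.
Proof. intros H1 H2 x y Hx; rewrite H1 by exact Hx; apply H2, Hx. Qed.

Lemma pd_eq_on i f g : eq_on f g -> eq_on (pd i f) (pd i g).
Proof.
  intros H x y Hx; destruct i; simpl.
  - apply Derive_ext_loc. generalize (locally_pos x Hx); apply filter_imp.
    intros t Ht; apply H, Ht.
  - apply Derive_ext; intros t; apply H, Hx.
Qed.

Definition c0_partials (f : sfun) : Prop :=
  forall x y, 0 < x -> continuity_2d_pt f x y
    /\ ex_derive (fun t => f t y) x /\ ex_derive (fun t => f x t) y.

Lemma c0_partials_eq_on f g : eq_on f g -> c0_partials f -> c0_partials g.
Proof.
  intros H Hf x y Hx; destruct (Hf x y Hx) as (C & D1 & D2); repeat split.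
  - apply continuity_2d_pt_ext_loc with (2 := C).
    now apply locally_2d_half_plane.
  - apply (ex_derive_ext_loc (fun t => f t y)); [|exact D1].
    generalize (locally_pos x Hx); apply filter_imp; intros t Ht; now apply H.
  - apply (ex_derive_ext (fun t => f x t)); [|exact D2].
    intros t; now apply H.
Qed.

(** To prove smoothness it suffices to exhibit a class of functions with
    continuous members that is stable under partial differentiation; this
    replaces an explicit formula for all the iterated derivatives. *)
Lemma smooth_of_stable (S : sfun -> Prop) :
  (forall f, S f -> c0_partials f) ->
  (forall f i, S f -> exists g, S g /\ eq_on (pd i f) g) ->
  forall f, S f -> smooth f.
Proof.
  intros HC HD f Hf w.
  assert (K : exists g, S g /\ eq_on (iter_pd w f) g).
  { induction w as [|i w (g & Hg & Eg)]; simpl.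
    - exists f; split; [exact Hf | easy].
    - destruct (HD g i Hg) as (h & Hh & Eh). exists h; split; [exact Hh|].
      apply eq_on_trans with (pd i g); [now apply pd_eq_on | exact Eh]. }
  destruct K as (g & Hg & Eg).
  exact (c0_partials_eq_on _ _ (eq_on_sym _ _ Eg) (HC g Hg)).
Qed.

Lemma smooth_c0_partials f : smooth f -> c0_partials f.
Proof. intros H; exact (H []). Qed.

Lemma smooth_pd i f : smooth f -> smooth (pd i f).
Proof.
  intros H w x y Hx.
  assert (K : forall w, iter_pd w (pd i f) = iter_pd (w ++ [i]) f).
  { intros w'; induction w' as [|j w' IH]; simpl; [easy | now rewrite IH]. }
  rewrite K; now apply H.
Qed.

(** Smoothness only sees the half plane, since it is open. *)
Lemma smooth_eq_on f g : eq_on f g -> smooth f -> smooth g.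
Proof.
  intros H Hf.
  apply (smooth_of_stable (fun h => exists k, smooth k /\ eq_on k h)).
  - intros h (k & Hk & E). apply (c0_partials_eq_on k); [exact E|].
    now apply smooth_c0_partials.
  - intros h i (k & Hk & E). exists (pd i k); split.
    + exists (pd i k); split; [now apply smooth_pd | easy].
    + apply eq_on_sym, pd_eq_on, E.
  - exists f; now split.
Qed.

Lemma smooth_differentiable f x y :
  smooth f -> 0 < x -> differentiable_pt_lim f x y (pd I1 f x y) (pd I2 f x y).
Proof.
  intros Hf Hx.
  apply filterdiff_differentiable_pt_lim.
  apply (filterdiff_ext_lin _ (fun u : R * R =>
    plus (scal (fst u) (pd I1 f x y)) (scal (snd u) (pd I2 f x y)))); [|easy].
  apply (is_derive_filterdiff f x y (pd I1 f) (pd I2 f x y)).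
  - apply locally_2d_locally with (P := fun u v => is_derive (fun z => f z v) u (pd I1 f u v)).
    apply locally_2d_half_plane; [exact Hx|]. intros u v Hu.
    apply Derive_correct, (smooth_c0_partials f Hf u v Hu).
  - apply Derive_correct, (smooth_c0_partials f Hf x y Hx).
  - apply (continuity_2d_pt_filterlim (pd I1 f)).
    apply (smooth_c0_partials _ (smooth_pd I1 f Hf) x y Hx).
Qed.

Lemma smooth_is_derive1 f x y :
  smooth f -> 0 < x -> is_derive (fun t => f t y) x (pd I1 f x y).
Proof. intros Hf Hx; apply Derive_correct, (smooth_c0_partials f Hf x y Hx). Qed.

Lemma smooth_is_derive2 f x y :
  smooth f -> 0 < x -> is_derive (fun t => f x t) y (pd I2 f x y).
Proof. intros Hf Hx; apply Derive_correct, (smooth_c0_partials f Hf x y Hx). Qed.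

Lemma pd_comm f x y : smooth f -> 0 < x -> pd I1 (pd I2 f) x y = pd I2 (pd I1 f) x y.
Proof.
  intros Hf Hx; apply (Schwarz f x y).
  - apply locally_2d_half_plane; [exact Hx|]; intros u v Hu.
    destruct (smooth_c0_partials f Hf u v Hu) as (_ & D1 & D2).
    destruct (smooth_c0_partials _ (smooth_pd I1 f Hf) u v Hu) as (_ & _ & D12).
    destruct (smooth_c0_partials _ (smooth_pd I2 f Hf) u v Hu) as (_ & D21 & _).
    now repeat split.
  - apply (Hf [I1; I2] x y Hx).
  - apply (Hf [I2; I1] x y Hx).
Qed.

Lemma is_derive_lin (f g : R -> R) (p q x l m : R) :
  is_derive f x l -> is_derive g x m ->
  is_derive (fun t => p * f t + q * g t) x (p * l + q * m).
Proof.
  intros Hf Hg.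
  apply (is_derive_plus (fun t => p * f t) (fun t => q * g t)).
  - now apply (is_derive_scal f x p l).
  - now apply (is_derive_scal g x q m).
Qed.

Lemma smooth_lin p q f g :
  smooth f -> smooth g -> smooth (fun x y => p * f x y + q * g x y).
Proof.
  intros Hf Hg.
  apply (smooth_of_stable (fun h => exists f g, smooth f /\ smooth g /\
    h = (fun x y => p * f x y + q * g x y))).
  - intros h (f' & g' & Hf' & Hg' & ->) x y Hx; repeat split.
    + destruct (smooth_c0_partials f' Hf' x y Hx) as (C & _).
      destruct (smooth_c0_partials g' Hg' x y Hx) as (C' & _).
      apply continuity_2d_pt_plus; apply continuity_2d_pt_mult;
        try apply continuity_2d_pt_const; assumption.
    + eexists; apply is_derive_lin; now apply smooth_is_derive1.
    + eexists; apply is_derive_lin; now apply smooth_is_derive2.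
  - intros h i (f' & g' & Hf' & Hg' & ->).
    exists (fun x y => p * pd i f' x y + q * pd i g' x y); split.
    + exists (pd i f'), (pd i g'); auto using smooth_pd.
    + intros x y Hx; destruct i; apply is_derive_unique.
      * apply is_derive_lin; now apply smooth_is_derive1.
      * apply is_derive_lin; now apply smooth_is_derive2.
  - now exists f, g.
Qed.

(** Pull-back of functions along the isomorphisms between models. *)
Definition shear (A B : R) (f : sfun) : sfun := fun x y => f x (A * x + B * y).

Lemma shear_differentiable A B f x y : smooth f -> 0 < x ->
  differentiable_pt_lim (shear A B f) x y
    (shear A B (pd I1 f) x y + A * shear A B (pd I2 f) x y)
    (B * shear A B (pd I2 f) x y).
Proof.
  intros Hf Hx.
  replace (shear A B (pd I1 f) x y + A * shear A B (pd I2 f) x y)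
    with (pd I1 f x (A * x + B * y) * 1 + pd I2 f x (A * x + B * y) * A)
    by (unfold shear; ring).
  replace (B * shear A B (pd I2 f) x y)
    with (pd I1 f x (A * x + B * y) * 0 + pd I2 f x (A * x + B * y) * B)
    by (unfold shear; ring).
  apply (differentiable_pt_lim_comp f (fun u v => u) (fun u v => A * u + B * v)).
  - now apply smooth_differentiable.
  - apply (differentiable_pt_lim_proj1_0 (fun u => u)).
    apply derivable_pt_lim_id.
  - intros eps; exists eps; intros u v _ _.
    replace (_ - _) with 0 by ring. rewrite Rabs_R0.
    apply Rmult_le_pos; [apply Rlt_le, cond_pos|].
    apply Rle_trans with (1 := Rabs_pos (u - x)), Rmax_l.
Qed.

Lemma pd1_shear A B f x y : smooth f -> 0 < x ->
  pd I1 (shear A B f) x y = shear A B (pd I1 f) x y + A * shear A B (pd I2 f) x y.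
Proof.
  intros Hf Hx.
  apply (differentiable_pt_lim_unique _ _ _ _ _ (shear_differentiable A B f x y Hf Hx)).
Qed.

Lemma pd2_shear A B f x y : smooth f -> 0 < x ->
  pd I2 (shear A B f) x y = B * shear A B (pd I2 f) x y.
Proof.
  intros Hf Hx.
  apply (differentiable_pt_lim_unique _ _ _ _ _ (shear_differentiable A B f x y Hf Hx)).
Qed.

Lemma smooth_shear A B f : smooth f -> smooth (shear A B f).
Proof.
  intros Hf.
  apply (smooth_of_stable (fun h => exists f, smooth f /\ h = shear A B f)).
  - intros h (g & Hg & ->) x y Hx.
    pose proof (shear_differentiable A B g x y Hg Hx) as D; repeat split.
    + apply differentiable_continuity_pt. now eexists; eexists; exact D.
    + change (fun t => shear A B g t y) with (fun t => shear A B g ((fun z => z) t) ((fun _ => y) t)).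
      eexists; apply is_derive_Reals.
      apply (derivable_pt_lim_comp_2d (shear A B g) (fun z => z) (fun _ => y)).
      * exact D.
      * apply derivable_pt_lim_id.
      * apply derivable_pt_lim_const.
    + change (fun t => shear A B g x t) with (fun t => shear A B g ((fun _ => x) t) ((fun z => z) t)).
      eexists; apply is_derive_Reals.
      apply (derivable_pt_lim_comp_2d (shear A B g) (fun _ => x) (fun z => z)).
      * exact D.
      * apply derivable_pt_lim_const.
      * apply derivable_pt_lim_id.
  - intros h i (g & Hg & ->); destruct i.
    + exists (shear A B (fun x y => 1 * pd I1 g x y + A * pd I2 g x y)); split.
      * eexists; split; [|reflexivity]. apply smooth_lin; now apply smooth_pd.
      * intros x y Hx; rewrite pd1_shear by assumption; unfold shear; ring.
    + exists (shear A B (fun x y => B * pd I2 g x y + 0 * pd I2 g x y)); split.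
      * eexists; split; [|reflexivity]. apply smooth_lin; now apply smooth_pd.
      * intros x y Hx; rewrite pd2_shear by assumption; unfold shear; ring.
  - now exists f.
Qed.

(** This class contains all the solutions of the normal forms and is stable
    under both partial derivatives. *)
Definition powlin (al k0 k1 k2 : R) : sfun :=
  fun x y => Rpower x al * (k0 + k1 * x + k2 * y).

Lemma Rpower_succ x al : 0 < x -> Rpower x al = x * Rpower x (al - 1).
Proof.
  intros Hx. rewrite <- (Rpower_1 x) at 2 by exact Hx.
  rewrite <- Rpower_plus. f_equal; ring.
Qed.

Lemma is_derive_powlin1 al k0 k1 k2 x y : 0 < x ->
  is_derive (fun t => powlin al k0 k1 k2 t y) x
    (powlin (al - 1) (al * k0) ((al + 1) * k1) (al * k2) x y).
Proof.
  intros Hx. unfold powlin.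
  replace (Rpower x (al - 1) * (al * k0 + (al + 1) * k1 * x + al * k2 * y))
    with (plus (scal (al * Rpower x (al - 1)) (k0 + k1 * x + k2 * y))
               (scal (Rpower x al) k1))
    by (rewrite (Rpower_succ x al Hx); unfold plus, scal; simpl;
        unfold mult; simpl; ring).
  apply (is_derive_mult (fun t => Rpower t al) (fun t => k0 + k1 * t + k2 * y)).
  - now apply is_derive_Reals, derivable_pt_lim_power.
  - auto_derive; [easy | ring].
  - intros n m; apply Rmult_comm.
Qed.

Lemma is_derive_powlin2 al k0 k1 k2 x y :
  is_derive (fun t => powlin al k0 k1 k2 x t) y (powlin al k2 0 0 x y).
Proof. unfold powlin; auto_derive; [easy|ring]. Qed.

Lemma smooth_powlin al k0 k1 k2 : smooth (powlin al k0 k1 k2).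
Proof.
  apply (smooth_of_stable (fun h => exists al k0 k1 k2, h = powlin al k0 k1 k2)).
  - intros h (be & l0 & l1 & l2 & ->) x y Hx; repeat split.
    + apply continuity_2d_pt_mult.
      * apply (continuity_1d_2d_pt_comp (fun t => Rpower t be) (fun u _ => u)).
        -- apply derivable_continuous_pt. eexists. now apply derivable_pt_lim_power.
        -- apply continuity_2d_pt_id1.
      * repeat (apply continuity_2d_pt_plus || apply continuity_2d_pt_mult
          || apply continuity_2d_pt_const || apply continuity_2d_pt_id1
          || apply continuity_2d_pt_id2).
    + eexists; now apply is_derive_powlin1.
    + eexists; now apply is_derive_powlin2.
  - intros h i (be & l0 & l1 & l2 & ->); destruct i.
    + eexists; split; [now repeat eexists|].
      intros x y Hx; now apply is_derive_unique, is_derive_powlin1.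
    + eexists; split; [now repeat eexists|].
      intros x y Hx; now apply is_derive_unique, is_derive_powlin2.
  - now exists al, k0, k1, k2.
Qed.

(** * Ricci tensor and the system for the jets *)

(** The constants [x^2 rho_ij]. *)
Definition ric (M : typeB) (i j : idx) : R :=
  let C := coef M in
  match i, j with
  | I1, I1 => C I1 I2 I2 * (1 + C I1 I1 I1 - C I1 I2 I2)
              + C I1 I1 I2 * (C I2 I2 I2 - C I1 I2 I1)
  | I1, I2 => C I2 I2 I2 + C I1 I2 I1 * C I1 I2 I2 - C I1 I1 I2 * C I2 I2 I1
  | I2, I1 => - C I1 I2 I1 + C I1 I2 I1 * C I1 I2 I2 - C I1 I1 I2 * C I2 I2 I1
  | I2, I2 => C I2 I2 I1 * (C I1 I1 I1 - C I1 I2 I2 - 1)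
              + C I1 I2 I1 * (C I2 I2 I2 - C I1 I2 I1)
  end.

Definition ric_s (M : typeB) (i j : idx) : R := (ric M i j + ric M j i) / 2.

Definition homog_vf (z : idx -> R) : vfield := fun k x _ => / x * z k.

Lemma nabla_frame_frame M i j :
  nabla (conn M) (frame i) (frame j) = homog_vf (coef M i j).
Proof.
  apply functional_extensionality; intros k.
  apply functional_extensionality; intros x.
  apply functional_extensionality; intros y.
  unfold nabla, sum2, homog_vf, conn.
  destruct i, j, k; simpl; rewrite ?Derive_const; ring.
Qed.

Lemma nabla_frame_homog M i z k x y : 0 < x ->
  nabla (conn M) (frame i) (homog_vf z) k x y =
  (sum2 (fun j => coef M i j k * z j)
   - match i with I1 => z k | I2 => 0 end) / x ^ 2.
Proof.
  intros Hx. unfold nabla, sum2, homog_vf, conn.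
  assert (D : Derive (fun t => / t * z k) x = - z k / x ^ 2).
  { apply is_derive_unique; auto_derive; [lra | field; lra]. }
  destruct i; simpl; rewrite D, Derive_const; field; lra.
Qed.

Lemma rho_homog M i j x y : 0 < x -> rho (conn M) i j x y = ric M i j / x ^ 2.
Proof.
  intros Hx. unfold rho, ricci, curv, sum2 at 1.
  assert (B : forall p q Z k,
    nabla (conn M) (bracket (frame p) (frame q)) Z k x y = 0).
  { intros p q Z k. unfold nabla, bracket, sum2.
    destruct p, q; simpl; rewrite ?Derive_const; ring. }
  rewrite !B, !nabla_frame_frame, !nabla_frame_homog by exact Hx.
  unfold sum2, ric.
  destruct i, j; rewrite ?(coef_sym M I2 I1 I1), ?(coef_sym M I2 I1 I2);
    simpl; field; lra.
Qed.

Lemma rho_s_homog M i j x y : 0 < x -> rho_s (conn M) i j x y = ric_s M i j / x ^ 2.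
Proof.
  intros Hx. unfold rho_s, ric_s. rewrite !rho_homog by exact Hx. field; lra.
Qed.

Lemma rho_tilde_homog M i j x y : 0 < x -> rho_tilde M i j x y = ric M i j.
Proof. intros Hx; unfold rho_tilde; rewrite rho_homog by exact Hx; field; lra. Qed.

Lemma E_iff mu M f :
  E mu (conn M) f <->
  smooth f /\ forall i j x y, 0 < x ->
    pd i (pd j f) x y =
      sum2 (fun k => coef M i j k * pd k f x y) / x
      + mu * ric_s M i j * f x y / x ^ 2.
Proof.
  unfold E, hess, conn, sum2.
  split; intros (Hs & H); split; try exact Hs; intros i j x y Hx;
    specialize (H i j x y Hx); fold (conn M) in *; rewrite rho_s_homog in * by exact Hx.
  - apply Rminus_diag_uniq. apply Rminus_diag_eq in H. rewrite <- H; field; lra.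
  - apply Rminus_diag_uniq. apply Rminus_diag_eq in H. rewrite <- H; field; lra.
Qed.

(** Scaled jets, and linear forms on them. *)
Definition vec : Type := (R * R * R)%type.

Definition dot (l w : vec) : R :=
  let '(l0, l1, l2) := l in let '(w0, w1, w2) := w in
  l0 * w0 + l1 * w1 + l2 * w2.

(** The factors [x] make the system of a solution homogeneous, so that it has
    constant coefficients. *)
Definition jet (f : sfun) (x y : R) : vec :=
  (f x y, x * pd I1 f x y, x * pd I2 f x y).

(** The action of [x d/dx] on the jets of a solution. *)
Definition jetX (mu : R) (M : typeB) (w : vec) : vec :=
  let '(w0, w1, w2) := w in
  (w1,
   mu * ric_s M I1 I1 * w0 + (1 + coef M I1 I1 I1) * w1 + coef M I1 I1 I2 * w2,
   mu * ric_s M I1 I2 * w0 + coef M I1 I2 I1 * w1 + (1 + coef M I1 I2 I2) * w2).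

(** The action of [x d/dy] on the jets of a solution. *)
Definition jetY (mu : R) (M : typeB) (w : vec) : vec :=
  let '(w0, w1, w2) := w in
  (w2,
   mu * ric_s M I1 I2 * w0 + coef M I1 I2 I1 * w1 + coef M I1 I2 I2 * w2,
   mu * ric_s M I2 I2 * w0 + coef M I2 I2 I1 * w1 + coef M I2 I2 I2 * w2).

Definition jetX_dual (mu : R) (M : typeB) (l : vec) : vec :=
  let '(l0, l1, l2) := l in
  (mu * ric_s M I1 I1 * l1 + mu * ric_s M I1 I2 * l2,
   l0 + (1 + coef M I1 I1 I1) * l1 + coef M I1 I2 I1 * l2,
   coef M I1 I1 I2 * l1 + (1 + coef M I1 I2 I2) * l2).

Definition jetY_dual (mu : R) (M : typeB) (l : vec) : vec :=
  let '(l0, l1, l2) := l in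
  (mu * ric_s M I1 I2 * l1 + mu * ric_s M I2 I2 * l2,
   coef M I1 I2 I1 * l1 + coef M I2 I2 I1 * l2,
   l0 + coef M I1 I2 I2 * l1 + coef M I2 I2 I2 * l2).

Lemma dot_jetX mu M l w : dot l (jetX mu M w) = dot (jetX_dual mu M l) w.
Proof. destruct l as [[]], w as [[]]; simpl; ring. Qed.

Lemma dot_jetY mu M l w : dot l (jetY mu M w) = dot (jetY_dual mu M l) w.
Proof. destruct l as [[]], w as [[]]; simpl; ring. Qed.

Lemma is_derive_eq (f : R -> R) (x l m : R) : is_derive f x l -> l = m -> is_derive f x m.
Proof. now intros H <-. Qed.

Lemma jet_derive1 mu M f l x y : E mu (conn M) f -> 0 < x ->
  is_derive (fun t => dot l (jet f t y)) x (dot l (jetX mu M (jet f x y)) / x).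
Proof.
  intros HE Hx; apply E_iff in HE; destruct HE as (Hs & H).
  destruct l as [[l0 l1] l2].
  pose proof (smooth_is_derive1 f x y Hs Hx) as D0.
  pose proof (smooth_is_derive1 _ x y (smooth_pd I1 f Hs) Hx) as D1.
  pose proof (smooth_is_derive1 _ x y (smooth_pd I2 f Hs) Hx) as D2.
  apply (is_derive_mult (fun t => t) _ x 1) in D1;
    [|auto_derive; easy|intros; apply Rmult_comm].
  apply (is_derive_mult (fun t => t) _ x 1) in D2;
    [|auto_derive; easy|intros; apply Rmult_comm].
  pose proof (is_derive_lin _ _ 1 1 _ _ _
    (is_derive_lin _ _ l0 l1 _ _ _ D0 D1) (is_derive_scal _ _ l2 _ D2)) as D.
  eapply is_derive_ext; [|eapply (is_derive_eq _ _ _ _ D)].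
  - intros t; unfold jet; simpl; unfold mult; simpl; ring.
  - rewrite !H by exact Hx; unfold sum2, jet, plus, scal, mult; simpl.
    unfold mult; simpl; field; lra.
Qed.

Lemma jet_derive2 mu M f l x y : E mu (conn M) f -> 0 < x ->
  is_derive (fun t => dot l (jet f x t)) y (dot l (jetY mu M (jet f x y)) / x).
Proof.
  intros HE Hx; apply E_iff in HE; destruct HE as (Hs & H).
  destruct l as [[l0 l1] l2].
  pose proof (smooth_is_derive2 f x y Hs Hx) as D0.
  pose proof (smooth_is_derive2 _ x y (smooth_pd I1 f Hs) Hx) as D1.
  pose proof (smooth_is_derive2 _ x y (smooth_pd I2 f Hs) Hx) as D2.
  pose proof (is_derive_lin _ _ 1 x _ _ _ (is_derive_scal _ _ l0 _ D0)
    (is_derive_lin _ _ l1 l2 _ _ _ D1 D2)) as D.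
  eapply is_derive_ext; [|eapply (is_derive_eq _ _ _ _ D)].
  - intros t; unfold jet; simpl; ring.
  - rewrite !H by exact Hx; unfold sum2, jet.
    rewrite (coef_sym M I2 I1 I1), (coef_sym M I2 I1 I2).
    replace (ric_s M I2 I1) with (ric_s M I1 I2) by (unfold ric_s; field).
    simpl; field; lra.
Qed.

Lemma derive_zero_on (g : sfun) i x y l :
  (forall u v, 0 < u -> g u v = 0) -> 0 < x ->
  match i with I1 => is_derive (fun t => g t y) x l
             | I2 => is_derive (fun t => g x t) y l end -> l = 0.
Proof.
  intros Hg Hx D.
  assert (K : pd i g x y = pd i (fun _ _ => 0) x y).
  { apply pd_eq_on; [|exact Hx]. intros u v Hu; now apply Hg. }
  destruct i; simpl in K; rewrite Derive_const in K; rewrite <- K; symmetry;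
    now apply is_derive_unique.
Qed.

(** The linear span of all the jets of [f], described as the common zeros of
    the linear forms that vanish on these jets: such a form may be
    differentiated along the half plane, which is how invariance under [jetX]
    and [jetY] is obtained. *)
Definition jet_hull (f : sfun) (w : vec) : Prop :=
  forall l, (forall x y, 0 < x -> dot l (jet f x y) = 0) -> dot l w = 0.

Lemma jet_hull_jet f x y : 0 < x -> jet_hull f (jet f x y).
Proof. intros Hx l Hl; now apply Hl. Qed.

Lemma jet_hull_jetX mu M f w : E mu (conn M) f ->
  jet_hull f w -> jet_hull f (jetX mu M w).
Proof.
  intros HE Hw l Hl; rewrite dot_jetX; apply Hw; intros x y Hx.
  rewrite <- dot_jetX.
  pose proof (derive_zero_on (fun u v => dot l (jet f u v)) I1 x y _ Hl Hx
    (jet_derive1 mu M f l x y HE Hx)) as K.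
  apply Rmult_eq_reg_r with (/ x); [|apply Rinv_neq_0_compat; lra].
  rewrite Rmult_0_l; exact K.
Qed.

Lemma jet_hull_jetY mu M f w : E mu (conn M) f ->
  jet_hull f w -> jet_hull f (jetY mu M w).
Proof.
  intros HE Hw l Hl; rewrite dot_jetY; apply Hw; intros x y Hx.
  rewrite <- dot_jetY.
  pose proof (derive_zero_on (fun u v => dot l (jet f u v)) I2 x y _ Hl Hx
    (jet_derive2 mu M f l x y HE Hx)) as K.
  apply Rmult_eq_reg_r with (/ x); [|apply Rinv_neq_0_compat; lra].
  rewrite Rmult_0_l; exact K.
Qed.

Definition vadd (v w : vec) : vec :=
  let '(v0, v1, v2) := v in let '(w0, w1, w2) := w in (v0 + w0, v1 + w1, v2 + w2).

Lemma is_derive_over_square (g : R -> R) (x l : R) : 0 < x -> is_derive g x l ->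
  is_derive (fun t => g t / t ^ 2) x ((x * l - 2 * g x) / x ^ 3).
Proof.
  intros Hx Hg.
  eapply is_derive_eq.
  - apply (is_derive_div g (fun t => t ^ 2)); [exact Hg|auto_derive; easy|].
    apply pow_nonzero; lra.
  - simpl; field; lra.
Qed.

Definition unit_covec (i : idx) : vec :=
  match i with I1 => (0, 1, 0) | I2 => (0, 0, 1) end.

(** The equality of mixed third derivatives: for [g] one of [f_1, f_2], both
    [g_1] and [g_2] are linear forms in the jet divided by [x^2], and
    differentiating these expressions once more gives the two sides. *)
Lemma jet_commutator_component mu M f i x y : E mu (conn M) f -> 0 < x ->
  dot (unit_covec i) (jetY mu M (jetX mu M (jet f x y))) =
  dot (unit_covec i) (jetX mu M (jetY mu M (jet f x y)))
  + dot (unit_covec i) (jetY mu M (jet f x y)).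
Proof.
  intros HE Hx. pose proof HE as HE'; apply E_iff in HE'; destruct HE' as (Hs & H).
  set (l := unit_covec i).
  pose proof (pd_comm (pd i f) x y (smooth_pd i f Hs) Hx) as S.
  assert (F2 : eq_on (pd I2 (pd i f))
                 (fun u v => dot (jetY_dual mu M l) (jet f u v) / u ^ 2)).
  { intros u v Hu. rewrite <- dot_jetY, H by exact Hu.
    destruct i; unfold l, jet, sum2; simpl;
      rewrite ?(coef_sym M I2 I1 I1), ?(coef_sym M I2 I1 I2);
      try replace (ric_s M I2 I1) with (ric_s M I1 I2) by (unfold ric_s; field);
      field; lra. }
  assert (F1 : eq_on (pd I1 (pd i f))
     (fun u v => (dot (jetX_dual mu M l) (jet f u v) - dot l (jet f u v)) / u ^ 2)).
  { intros u v Hu. rewrite <- dot_jetX, H by exact Hu.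
    destruct i; unfold l, jet, sum2; simpl; field; lra. }
  rewrite (pd_eq_on I1 _ _ F2 x y Hx), (pd_eq_on I2 _ _ F1 x y Hx) in S.
  assert (L : pd I1 (fun u v => dot (jetY_dual mu M l) (jet f u v) / u ^ 2) x y
    = (dot l (jetY mu M (jetX mu M (jet f x y)))
       - 2 * dot l (jetY mu M (jet f x y))) / x ^ 3).
  { apply is_derive_unique.
    eapply is_derive_eq.
    - apply is_derive_over_square; [exact Hx|].
      exact (jet_derive1 mu M f (jetY_dual mu M l) x y HE Hx).
    - rewrite <- !dot_jetY; field; lra. }
  assert (K : pd I2 (fun u v =>
      (dot (jetX_dual mu M l) (jet f u v) - dot l (jet f u v)) / u ^ 2) x y
    = (dot l (jetX mu M (jetY mu M (jet f x y)))
       - dot l (jetY mu M (jet f x y))) / x ^ 3).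
  { apply is_derive_unique.
    eapply is_derive_ext; [|eapply is_derive_eq; [apply (is_derive_lin
      (fun t => dot (jetX_dual mu M l) (jet f x t)) (fun t => dot l (jet f x t))
      (/ x ^ 2) (- / x ^ 2) y _ _ (jet_derive2 mu M f _ x y HE Hx)
      (jet_derive2 mu M f _ x y HE Hx))|]].
    - intros t; simpl; field; lra.
    - rewrite <- !dot_jetX; field; lra. }
  rewrite L, K in S.
  apply (f_equal (fun z => x ^ 3 * z)) in S.
  field_simplify in S; try lra.
Qed.

(** * Nilpotency of the translation operator *)

Definition vscal (k : R) (v : vec) : vec :=
  let '(v0, v1, v2) := v in (k * v0, k * v1, k * v2).

Definition vzero : vec := (0, 0, 0).

Lemma dot_vadd l m w : dot (vadd l m) w = dot l w + dot m w.
Proof. destruct l as [[]], m as [[]], w as [[]]; simpl; ring. Qed.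

Lemma dot_vscal k l w : dot (vscal k l) w = k * dot l w.
Proof. destruct l as [[]], w as [[]]; simpl; ring. Qed.

(** Unlike [f_equal], this stops at the three components. *)
Lemma vec_eq (v0 v1 v2 w0 w1 w2 : R) :
  v0 = w0 -> v1 = w1 -> v2 = w2 -> (v0, v1, v2) = (w0, w1, w2).
Proof. now intros -> -> ->. Qed.

Ltac vec_ring := repeat match goal with v : vec |- _ => destruct v as [[? ?] ?] end;
  unfold vzero; simpl; apply vec_eq; ring.

Lemma jetX_vadd mu M v w : jetX mu M (vadd v w) = vadd (jetX mu M v) (jetX mu M w).
Proof. vec_ring. Qed.

Lemma jetX_vscal mu M k w : jetX mu M (vscal k w) = vscal k (jetX mu M w).
Proof. vec_ring. Qed.

Lemma jetY_vadd mu M v w : jetY mu M (vadd v w) = vadd (jetY mu M v) (jetY mu M w).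
Proof. vec_ring. Qed.

(** The first component holds by the shape of the two matrices; the other two
    are linear relations between the jets, hence extend to their hull. *)
Lemma jet_hull_commutator mu M f w : E mu (conn M) f -> jet_hull f w ->
  jetY mu M (jetX mu M w) = vadd (jetX mu M (jetY mu M w)) (jetY mu M w).
Proof.
  intros HE Hw.
  assert (K : forall i, dot (unit_covec i) (jetY mu M (jetX mu M w)) =
    dot (unit_covec i) (jetX mu M (jetY mu M w)) + dot (unit_covec i) (jetY mu M w)).
  { intros i; set (e := unit_covec i).
    pose proof (Hw (vadd (jetX_dual mu M (jetY_dual mu M e))
      (vscal (-1) (vadd (jetY_dual mu M (jetX_dual mu M e)) (jetY_dual mu M e))))) as L.
    rewrite !dot_vadd, dot_vscal, dot_vadd, <- !dot_jetX, <- !dot_jetY,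
      <- dot_jetX in L.
    cut (forall p q r, p + -1 * (q + r) = 0 -> p = q + r); [|intros; lra].
    intros C; apply C, L; intros x y Hx.
    rewrite !dot_vadd, dot_vscal, dot_vadd, <- !dot_jetX, <- !dot_jetY, <- dot_jetX.
    unfold e; rewrite jet_commutator_component by assumption; ring. }
  pose proof (K I1) as K1; pose proof (K I2) as K2; clear K.
  destruct w as [[w0 w1] w2]; unfold unit_covec in K1, K2; simpl in *.
  apply vec_eq; lra.
Qed.

Definition cubic mu M (p3 p2 p1 p0 : R) (w : vec) : vec :=
  let Y := jetY mu M in
  vadd (vadd (vscal p3 (Y (Y (Y w)))) (vscal p2 (Y (Y w))))
       (vadd (vscal p1 (Y w)) (vscal p0 w)).

Lemma cayley_hamilton_jetY mu M w :
  cubic mu M 1 (- (coef M I1 I2 I1 + coef M I2 I2 I2))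
    (coef M I1 I2 I1 * coef M I2 I2 I2 - coef M I1 I2 I2 * coef M I2 I2 I1
     - mu * ric_s M I2 I2)
    (- (mu * ric_s M I1 I2 * coef M I2 I2 I1 - coef M I1 I2 I1 * (mu * ric_s M I2 I2)))
    w = vzero.
Proof. unfold cubic; vec_ring. Qed.

(** The commutator relation gives [Y^k X = X Y^k + k Y^k] on the hull, so
    bracketing a polynomial in [Y] with [X] applies [t d/dt] to it. *)
Lemma cubic_euler mu M f p3 p2 p1 p0 : E mu (conn M) f ->
  (forall w, jet_hull f w -> cubic mu M p3 p2 p1 p0 w = vzero) ->
  forall w, jet_hull f w -> cubic mu M (3 * p3) (2 * p2) p1 0 w = vzero.
Proof.
  intros HE H w Hw.
  pose proof (jet_hull_jetY mu M f w HE Hw) as HY.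
  pose proof (jet_hull_jetY mu M f _ HE HY) as HYY.
  pose proof (H w Hw) as H0.
  pose proof (H _ (jet_hull_jetX mu M f w HE Hw)) as H1.
  apply (f_equal (jetX mu M)) in H0.
  unfold cubic in *.
  rewrite !jetX_vadd, !jetX_vscal in H0.
  rewrite (jet_hull_commutator mu M f w HE Hw), !jetY_vadd,
    (jet_hull_commutator mu M f _ HE HY), !jetY_vadd,
    (jet_hull_commutator mu M f _ HE HYY) in H1.
  revert H0 H1.
  replace (jetX mu M vzero) with vzero by (unfold vzero; simpl; apply vec_eq; ring).
  generalize (jetX mu M (jetY mu M (jetY mu M (jetY mu M w))))
    (jetX mu M (jetY mu M (jetY mu M w))) (jetX mu M (jetY mu M w)) (jetX mu M w)
    (jetY mu M (jetY mu M (jetY mu M w))) (jetY mu M (jetY mu M w)) (jetY mu M w).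
  clear. intros a b c d a' b' c' Ha Hb.
  repeat match goal with v : vec |- _ => destruct v as [[? ?] ?] end.
  unfold vzero in *; simpl in *.
  injection Ha; injection Hb; intros.
  apply vec_eq; lra.
Qed.

(** Starting from the characteristic polynomial, whose coefficients at
    [Y^3, Y^2, Y] are [(1, p, q)], the Euler operator produces the relations
    [(3, 2 p, q)], [(9, 4 p, q)] and [(27, 8 p, q)], all without constant term.
    Twice the first, minus three times the second, plus the third is
    [6 Y^3]. *)
Lemma jetY_nilpotent mu M f w : E mu (conn M) f -> jet_hull f w ->
  jetY mu M (jetY mu M (jetY mu M w)) = vzero.
Proof.
  intros HE Hw.
  set (p := - (coef M I1 I2 I1 + coef M I2 I2 I2)).
  pose proof (cubic_euler mu M f _ _ _ _ HE (fun w _ => cayley_hamilton_jetY mu M w)) as H1.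
  pose proof (cubic_euler mu M f _ _ _ _ HE H1) as H2.
  pose proof (cubic_euler mu M f _ _ _ _ HE H2 w Hw) as H3.
  specialize (H1 w Hw); specialize (H2 w Hw).
  unfold cubic in *; revert H1 H2 H3.
  generalize (jetY mu M (jetY mu M (jetY mu M w)))
    (jetY mu M (jetY mu M w)) (jetY mu M w).
  intros a b c; fold p.
  intros H1 H2 H3.
  destruct a as [[? ?] ?], b as [[? ?] ?], c as [[? ?] ?], w as [[? ?] ?].
  unfold vzero in *; simpl in *.
  injection H1; injection H2; injection H3; clear.
  intros; apply vec_eq; lra.
Qed.

Lemma jet_hull_kernel mu M f x y : E mu (conn M) f -> 0 < x -> f x y <> 0 ->
  exists v, jet_hull f v /\ v <> vzero /\ jetY mu M v = vzero.
Proof.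
  intros HE Hx Hf.
  assert (dec : forall v : vec, v = vzero \/ v <> vzero).
  { intros [[a b] c]; unfold vzero.
    destruct (Req_dec a 0) as [->|]; [|right; congruence].
    destruct (Req_dec b 0) as [->|]; [|right; congruence].
    destruct (Req_dec c 0) as [->|]; [now left|right; congruence]. }
  pose proof (jet_hull_jet f x y Hx) as Hw.
  assert (Nw : jet f x y <> vzero).
  { unfold jet, vzero; intros K; now injection K. }
  revert Hw Nw; generalize (jet f x y); intros w Hw Nw.
  destruct (dec (jetY mu M w)) as [Z|N1]; [now exists w|].
  pose proof (jet_hull_jetY mu M f w HE Hw) as H1.
  destruct (dec (jetY mu M (jetY mu M w))) as [Z|N2]; [now exists (jetY mu M w)|].
  exists (jetY mu M (jetY mu M w)); repeat split; auto.
  - now apply jet_hull_jetY.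
  - now apply jetY_nilpotent with f.
Qed.

(** The jet [(v0, v1, 0)] is the kernel vector [v]; the four equations are
    [Y v = 0] and [Y (X v) = 0], the latter because [Y X v = X Y v + Y v]. *)
Lemma translation_invariant_jet mu M f x y :
  E mu (conn M) f -> 0 < x -> f x y <> 0 ->
  exists v0 v1, (v0 <> 0 \/ v1 <> 0)
    /\ mu * ric_s M I1 I2 * v0 + coef M I1 I2 I1 * v1 = 0
    /\ mu * ric_s M I2 I2 * v0 + coef M I2 I2 I1 * v1 = 0
    /\ mu * ric_s M I1 I2 * v1 + coef M I1 I2 I1 *
         (mu * ric_s M I1 I1 * v0 + (1 + coef M I1 I1 I1) * v1) = 0
    /\ mu * ric_s M I2 I2 * v1 + coef M I2 I2 I1 *
         (mu * ric_s M I1 I1 * v0 + (1 + coef M I1 I1 I1) * v1) = 0.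
Proof.
  intros HE Hx Hf.
  destruct (jet_hull_kernel mu M f x y HE Hx Hf) as (v & Hv & Nv & Yv).
  pose proof (jet_hull_commutator mu M f v HE Hv) as C.
  rewrite Yv in C.
  destruct v as [[v0 v1] v2]; unfold vzero in *; simpl in Yv, C.
  injection Yv; intros Y2 Y1 ->. injection C; intros C2 C1 C0.
  rewrite Rplus_0_r in C0; rewrite C0 in C1, C2.
  exists v0, v1; repeat split; try lra.
  destruct (Req_dec v0 0) as [->|]; [right|now left]. intros ->; now apply Nv.
Qed.

(** * Linear equivalence as a shear *)

(** The relation between the Christoffel constants, obtained by transporting
    [nabla_{d_i} d_j] of [M] with [d_1 = d'_1 + A d'_2] and [d_2 = B d'_2]. *)
Definition sheared (A B : R) (M N : typeB) : Prop :=
  coef M I1 I1 I1 = coef N I1 I1 I1 + 2 * A * coef N I1 I2 I1 + A ^ 2 * coef N I2 I2 I1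
  /\ A * coef M I1 I1 I1 + B * coef M I1 I1 I2
     = coef N I1 I1 I2 + 2 * A * coef N I1 I2 I2 + A ^ 2 * coef N I2 I2 I2
  /\ coef M I1 I2 I1 = B * (coef N I1 I2 I1 + A * coef N I2 I2 I1)
  /\ A * coef M I1 I2 I1 + B * coef M I1 I2 I2
     = B * (coef N I1 I2 I2 + A * coef N I2 I2 I2)
  /\ coef M I2 I2 I1 = B ^ 2 * coef N I2 I2 I1
  /\ A * coef M I2 I2 I1 + B * coef M I2 I2 I2 = B ^ 2 * coef N I2 I2 I2.

Lemma sheared_solved A B M N : B <> 0 -> sheared A B M N ->
  coef M I1 I1 I1 = coef N I1 I1 I1 + 2 * A * coef N I1 I2 I1 + A ^ 2 * coef N I2 I2 I1
  /\ coef M I1 I1 I2 = (coef N I1 I1 I2 + 2 * A * coef N I1 I2 I2 + A ^ 2 * coef N I2 I2 I2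
       - A * (coef N I1 I1 I1 + 2 * A * coef N I1 I2 I1 + A ^ 2 * coef N I2 I2 I1)) / B
  /\ coef M I1 I2 I1 = B * (coef N I1 I2 I1 + A * coef N I2 I2 I1)
  /\ coef M I1 I2 I2 = coef N I1 I2 I2 + A * coef N I2 I2 I2
       - A * (coef N I1 I2 I1 + A * coef N I2 I2 I1)
  /\ coef M I2 I2 I1 = B ^ 2 * coef N I2 I2 I1
  /\ coef M I2 I2 I2 = B * (coef N I2 I2 I2 - A * coef N I2 I2 I1).
Proof.
  intros HB (H1 & H2 & H3 & H4 & H5 & H6).
  rewrite H1 in H2; rewrite H3 in H4; rewrite H5 in H6.
  repeat split; try assumption; apply (Rmult_eq_reg_l B); try assumption.
  - field_simplify; [lra | assumption].
  - lra.
  - lra.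
Qed.

Lemma sheared_sym A B M N : B <> 0 ->
  sheared A B M N -> sheared (- A / B) (/ B) N M.
Proof.
  intros HB H; apply sheared_solved in H; [|exact HB].
  destruct H as (H1 & H2 & H3 & H4 & H5 & H6); unfold sheared.
  rewrite H1, H2, H3, H4, H5, H6; repeat split; field; assumption.
Qed.

(** The tensor [rho_s] of [M] is the pull-back of that of [N]. *)
Lemma ric_s_sheared A B M N : B <> 0 -> sheared A B M N ->
  ric_s M I1 I1 = ric_s N I1 I1 + 2 * A * ric_s N I1 I2 + A ^ 2 * ric_s N I2 I2
  /\ ric_s M I1 I2 = B * (ric_s N I1 I2 + A * ric_s N I2 I2)
  /\ ric_s M I2 I2 = B ^ 2 * ric_s N I2 I2.
Proof.
  intros HB H; apply sheared_solved in H; [|exact HB].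
  destruct H as (H1 & H2 & H3 & H4 & H5 & H6); unfold ric_s, ric.
  rewrite H1, H2, H3, H4, H5, H6; repeat split; field; assumption.
Qed.

Lemma nabla_frames_at_one M i j k y :
  nabla (conn M) (frame i) (frame j) k 1 y = coef M i j k.
Proof. rewrite nabla_frame_frame; unfold homog_vf; field. Qed.

Lemma smooth_const c : smooth (fun _ _ => c).
Proof.
  apply (smooth_of_stable (fun h => exists c, h = fun _ _ => c)).
  - intros h (k & ->) x y _; repeat split.
    + apply continuity_2d_pt_const.
    + apply ex_derive_const.
    + apply ex_derive_const.
  - intros h i (k & ->); exists (fun _ _ => 0); split; [now eexists|].
    intros x y _; destruct i; simpl; apply Derive_const.
  - now eexists.
Qed.

Lemma smooth_frame i : smooth_vf (frame i).
Proof. intros k; destruct i, k; exact (smooth_const _). Qed.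

(** It is enough to test the intertwining on the coordinate fields at [(1, 0)]. *)
Lemma sheared_of_lin_equiv M N :
  lin_equiv M N -> exists A B, B <> 0 /\ sheared A B M N.
Proof.
  intros (A & B & HB & H); exists A, B; split; [exact HB|].
  assert (K : forall i j k, push A B (nabla (conn M) (frame i) (frame j)) k 1 0
     = nabla (conn N) (push A B (frame i)) (push A B (frame j)) k 1 0).
  { intros i j k; apply H; [apply smooth_frame..|lra]. }
  unfold push at 1 in K.
  pose proof (K I1 I1 I1) as K1; pose proof (K I1 I1 I2) as K2.
  pose proof (K I1 I2 I1) as K3; pose proof (K I1 I2 I2) as K4.
  pose proof (K I2 I2 I1) as K5; pose proof (K I2 I2 I2) as K6; clear K H.
  cbv zeta in *; rewrite !nabla_frames_at_one in *.
  unfold nabla, push, conn, sum2 in *; simpl in *.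
  rewrite !Derive_const in *.
  rewrite !(coef_sym N I2 I1) in *.
  unfold sheared; repeat split; field_simplify in K1; field_simplify in K2;
  field_simplify in K3; field_simplify in K4; field_simplify in K5; field_simplify in K6;
  lra.
Qed.

Lemma pd_lin i p q f g x y : smooth f -> smooth g -> 0 < x ->
  pd i (fun u v => p * f u v + q * g u v) x y = p * pd i f x y + q * pd i g x y.
Proof.
  intros Hf Hg Hx; destruct i; apply is_derive_unique, is_derive_lin;
    now apply smooth_is_derive1 || apply smooth_is_derive2.
Qed.

Lemma lin_equiv_of_sheared A B M N : B <> 0 -> sheared A B M N -> lin_equiv M N.
Proof.
  intros HB H; exists A, B; split; [exact HB|].
  apply sheared_solved in H; [|exact HB].
  destruct H as (H1 & H2 & H3 & H4 & H5 & H6).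
  intros X Y HX HY k u v Hu.
  assert (P1 : forall Z, push A B Z I1 = shear (- A / B) (/ B) (Z I1)).
  { intros Z; apply functional_extensionality; intros x.
    apply functional_extensionality; intros y.
    unfold push, shear; f_equal; field; exact HB. }
  assert (P2 : forall Z, push A B Z I2 =
     shear (- A / B) (/ B) (fun x y => A * Z I1 x y + B * Z I2 x y)).
  { intros Z; apply functional_extensionality; intros x.
    apply functional_extensionality; intros y.
    unfold push, shear.
    replace (- A / B * x + / B * y) with ((y - A * x) / B) by (field; exact HB).
    reflexivity. }
  assert (D1 : forall f, smooth f -> pd I1 (shear (- A / B) (/ B) f) u v =
    pd I1 f u (- A / B * u + / B * v) - A / B * pd I2 f u (- A / B * u + / B * v)).
  { intros f Hf; rewrite pd1_shear by assumption; unfold shear; field; exact HB. }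
  assert (D2 : forall f, smooth f -> pd I2 (shear (- A / B) (/ B) f) u v =
    / B * pd I2 f u (- A / B * u + / B * v)).
  { intros f Hf; now rewrite pd2_shear. }
  unfold nabla at 2; unfold sum2.
  rewrite (P1 X), (P2 X).
  assert (Q : smooth (fun x y => A * Y I1 x y + B * Y I2 x y))
    by now apply smooth_lin.
  set (w := - A / B * u + / B * v) in *.
  assert (Ew : (v - A * u) / B = w) by (unfold w; field; exact HB).
  unfold push at 1; cbv zeta; rewrite Ew.
  unfold nabla, sum2, conn.
  destruct k.
  - rewrite (P1 Y), (P2 Y), D1, D2 by apply HY.
    unfold shear; fold w.
    rewrite H1, H3, H5, !(coef_sym M I2 I1 I1), !(coef_sym N I2 I1 I1), H3.
    field; lra.
  - rewrite (P1 Y), (P2 Y), D1, D2 by exact Q.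
    rewrite !pd_lin by (apply HY || exact Hu).
    unfold shear; fold w.
    rewrite !(coef_sym M I2 I1 I1), !(coef_sym M I2 I1 I2), !(coef_sym N I2 I1 I2).
    rewrite H1, H2, H3, H4, H5, H6.
    field; lra.
Qed.

(** Both sides of the Hessian equation transform as tensors. *)
Lemma E_shear A B mu M N f : B <> 0 -> sheared A B M N ->
  E mu (conn N) f -> E mu (conn M) (shear A B f).
Proof.
  intros HB H HE; apply E_iff in HE; destruct HE as (Hs & HE).
  destruct (ric_s_sheared A B M N HB H) as (R1 & R2 & R3).
  apply sheared_solved in H; [|exact HB].
  destruct H as (H1 & H2 & H3 & H4 & H5 & H6).
  apply E_iff; split; [now apply smooth_shear|].
  intros i j x y Hx.
  assert (F1 : eq_on (pd I1 (shear A B f))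
    (shear A B (fun u v => 1 * pd I1 f u v + A * pd I2 f u v))).
  { intros u v Hu; rewrite pd1_shear by assumption; unfold shear; ring. }
  assert (F2 : eq_on (pd I2 (shear A B f))
    (shear A B (fun u v => B * pd I2 f u v + 0 * pd I2 f u v))).
  { intros u v Hu; rewrite pd2_shear by assumption; unfold shear; ring. }
  assert (S1 := smooth_pd I1 f Hs); assert (S2 := smooth_pd I2 f Hs).
  unfold sum2. rewrite (F1 x y Hx), (F2 x y Hx).
  destruct i, j;
    rewrite ?(pd_eq_on _ _ _ F1 x y Hx), ?(pd_eq_on _ _ _ F2 x y Hx);
    rewrite ?pd1_shear, ?pd2_shear by (try apply smooth_lin; assumption);
    unfold shear; rewrite !pd_lin by assumption; rewrite !HE by assumption;
    unfold sum2;
    rewrite ?(coef_sym M I2 I1 I1), ?(coef_sym M I2 I1 I2),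
      ?(coef_sym N I2 I1 I1), ?(coef_sym N I2 I1 I2);
    rewrite ?H1, ?H2, ?H3, ?H4, ?H5, ?H6;
    replace (ric_s N I2 I1) with (ric_s N I1 I2) by (unfold ric_s; field);
    try replace (ric_s M I2 I1) with (ric_s M I1 I2) by (unfold ric_s; field);
    rewrite ?R1, ?R2, ?R3; field; lra.
Qed.

Lemma lincomb_shear A B ks fs x y :
  lincomb ks (map (shear A B) fs) x y = lincomb ks fs x (A * x + B * y).
Proof.
  revert fs; induction ks as [|k ks IH]; intros [|f fs]; simpl; try easy.
  now rewrite IH.
Qed.

Lemma lin_indep_shear A B fs : B <> 0 ->
  lin_indep fs -> lin_indep (map (shear A B) fs).
Proof.
  intros HB H ks L Z; rewrite length_map in L.
  apply H; [exact L|]; intros x y Hx.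
  rewrite <- (Z x ((y - A * x) / B) Hx), lincomb_shear.
  f_equal; field; exact HB.
Qed.

Lemma dim_ge_sheared A B mu M N n : B <> 0 -> sheared A B M N ->
  dim_ge (E mu (conn N)) n -> dim_ge (E mu (conn M)) n.
Proof.
  intros HB H (fs & L & F & I); exists (map (shear A B) fs); repeat split.
  - now rewrite length_map.
  - apply Forall_map; revert F; apply Forall_impl; intros f; now apply E_shear.
  - now apply lin_indep_shear.
Qed.

(** Only solutions can be transported, so the spanning property uses the
    inverse shear. *)
Lemma dim_eq_sheared A B mu M N n : B <> 0 -> sheared A B M N ->
  dim_eq (E mu (conn N)) n -> dim_eq (E mu (conn M)) n.
Proof.
  intros HB H (fs & L & F & I & S); exists (map (shear A B) fs); repeat split.
  - now rewrite length_map.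
  - apply Forall_map; revert F; apply Forall_impl; intros f; now apply E_shear.
  - now apply lin_indep_shear.
  - intros f Hf.
    assert (HB' : / B <> 0) by now apply Rinv_neq_0_compat.
    destruct (S _ (E_shear _ _ mu N M f HB' (sheared_sym A B M N HB H) Hf))
      as (ks & Lk & Ek).
    exists ks; split; [now rewrite length_map|].
    intros x y Hx; rewrite lincomb_shear, <- (Ek x _ Hx); unfold shear.
    f_equal; field; exact HB.
Qed.

(** * The normal form *)

Lemma sheared_exists A B M : B <> 0 -> exists N, sheared A B N M.
Proof.
  intros HB.
  set (G := fun i j k : idx => match i, j, k with
    | I1, I1, I1 => coef M I1 I1 I1 + 2 * A * coef M I1 I2 I1 + A ^ 2 * coef M I2 I2 I1
    | I1, I1, I2 => (coef M I1 I1 I2 + 2 * A * coef M I1 I2 I2 + A ^ 2 * coef M I2 I2 I2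
       - A * (coef M I1 I1 I1 + 2 * A * coef M I1 I2 I1 + A ^ 2 * coef M I2 I2 I1)) / B
    | I2, I2, I1 => B ^ 2 * coef M I2 I2 I1
    | I2, I2, I2 => B * (coef M I2 I2 I2 - A * coef M I2 I2 I1)
    | _, _, I1 => B * (coef M I1 I2 I1 + A * coef M I2 I2 I1)
    | _, _, I2 => coef M I1 I2 I2 + A * coef M I2 I2 I2
       - A * (coef M I1 I2 I1 + A * coef M I2 I2 I1)
    end).
  assert (S : forall i j k, G i j k = G j i k) by (now intros [] [] []).
  exists (TypeB G S). unfold sheared; simpl.
  repeat split; field; exact HB.
Qed.

Lemma sign_square s : s = 1 \/ s = -1 -> s * s = 1.
Proof. intros [-> | ->]; ring. Qed.

(** Seen from [N] to [M], the shear with [B = |e|^(-1/2)] makes [C_22^1] a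
    sign, and [A = - c / e] removes [C_12^1]. *)
Lemma normalizing_shear M : coef M I2 I2 I1 <> 0 ->
  exists s A B N, (s = 1 \/ s = -1) /\ B <> 0 /\ sheared A B M N
    /\ coef N I2 I2 I1 = s /\ coef N I1 I2 I1 = 0.
Proof.
  intros He; set (e := coef M I2 I2 I1) in *.
  assert (Hp : 0 < Rabs e) by now apply Rabs_pos_lt.
  set (B := / sqrt (Rabs e)).
  assert (Hq : sqrt (Rabs e) <> 0) by (apply Rgt_not_eq, sqrt_lt_R0, Hp).
  assert (HB : B <> 0) by now apply Rinv_neq_0_compat.
  destruct (sheared_exists (- coef M I1 I2 I1 / e) B M HB) as (N & H).
  exists (e / Rabs e), (- (- coef M I1 I2 I1 / e) / B), (/ B), N.
  split; [|split; [|split; [|split]]].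
  - unfold Rabs; destruct (Rcase_abs e); [right|left]; field; exact He.
  - now apply Rinv_neq_0_compat.
  - apply sheared_sym; assumption.
  - destruct H as (_ & _ & _ & _ & -> & _). fold e. unfold B.
    rewrite pow_inv. rewrite pow2_sqrt by lra. field; lra.
  - destruct H as (_ & _ & -> & _). fold e. field; exact He.
Qed.

Definition rho_s_nonzero (M : typeB) : Prop :=
  ~ (ric_s M I1 I1 = 0 /\ ric_s M I1 I2 = 0 /\ ric_s M I2 I2 = 0).

Lemma rho_s_nonzero_of_point M :
  (exists i j x y, 0 < x /\ rho_s (conn M) i j x y <> 0) -> rho_s_nonzero M.
Proof.
  intros (i & j & x & y & Hx & H) (R1 & R2 & R3); apply H.
  rewrite rho_s_homog by exact Hx.
  destruct i, j; try replace (ric_s M I2 I1) with (ric_s M I1 I2) by (unfold ric_s; field);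
    rewrite ?R1, ?R2, ?R3; field; lra.
Qed.

Lemma rho_s_nonzero_sheared A B M N : B <> 0 -> sheared A B M N ->
  rho_s_nonzero M -> rho_s_nonzero N.
Proof.
  intros HB H HM (R1 & R2 & R3); apply HM.
  destruct (ric_s_sheared A B M N HB H) as (-> & -> & ->).
  rewrite R1, R2, R3; repeat split; ring.
Qed.

(** For [e = 0] one has [x^2 rho_s22 = c (f - c)], which the kernel vector
    forces to vanish.  If [c = 0] then [x^2 rho_s12 = f / 2] vanishes too and
    the surface is of Type A.  If [f = c <> 0] then the vector is
    proportional to [(1, - mu d)] and the third equation reads
    [mu (mu + 1) d^2 = 0], so [d = 0] and [rho_s = 0]. *)
Lemma no_solution_when_C221_zero M mu f x y :
  rho_s_nonzero M ->
  (coef M I1 I2 I1, coef M I2 I2 I1, coef M I2 I2 I2) <> (0, 0, 0) ->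
  mu <> 0 -> mu <> -1 -> coef M I2 I2 I1 = 0 ->
  E mu (conn M) f -> 0 < x -> f x y = 0.
Proof.
  intros Hr HA H0 H1 He HE Hx.
  destruct (Req_dec (f x y) 0) as [Z|Hf]; [exact Z|exfalso].
  destruct (translation_invariant_jet mu M f x y HE Hx Hf)
    as (v0 & v1 & Hv & Q1 & Q2 & Q3 & Q4).
  unfold rho_s_nonzero, ric_s, ric in *; rewrite He in *.
  set (a := coef M I1 I1 I1) in *; set (b := coef M I1 I1 I2) in *.
  set (c := coef M I1 I2 I1) in *; set (d := coef M I1 I2 I2) in *.
  set (g := coef M I2 I2 I2) in *.
  assert (Hcg : c * (g - c) = 0).
  { destruct Hv as [Hv|Hv].
    - apply (Rmult_eq_reg_l mu); [|exact H0]. apply (Rmult_eq_reg_r v0); [|exact Hv]. lra.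
    - apply (Rmult_eq_reg_l mu); [|exact H0]. apply (Rmult_eq_reg_r v1); [|exact Hv]. lra. }
  destruct (Rmult_integral _ _ Hcg) as [Hc|Hc].
  - rewrite Hc in *.
    assert (Hg : g = 0).
    { destruct Hv as [Hv|Hv].
      - apply (Rmult_eq_reg_l mu); [|exact H0]. apply (Rmult_eq_reg_r v0); [|exact Hv]. lra.
      - apply (Rmult_eq_reg_l mu); [|exact H0]. apply (Rmult_eq_reg_r v1); [|exact Hv]. lra. }
    apply HA; now rewrite Hg.
  - assert (Hg : g = c) by lra; rewrite Hg in *.
    assert (Hc0 : c <> 0).
    { intros Z; apply HA; now rewrite Z. }
    assert (V1 : v1 = - mu * d * v0).
    { apply (Rmult_eq_reg_l c); [|exact Hc0]. lra. }
    assert (V0 : v0 <> 0).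
    { intros Z; destruct Hv as [Hv|Hv]; apply Hv; [exact Z|].
      rewrite V1, Z; ring. }
    rewrite V1 in Q3.
    assert (K : (mu * (mu + 1) * c * v0) * (d * d) = 0) by lra.
    assert (Hd : d = 0).
    { apply Rmult_integral in K; destruct K as [K|K].
      - exfalso; revert K; repeat apply Rmult_integral_contrapositive_currified; lra.
      - apply Rmult_integral in K; lra. }
    apply Hr; rewrite Hd; repeat split; field.
Qed.

(** The kernel vector is proportional to [(1, mu Delta)], the jet of
    [x^(mu Delta)], by its second equation; the first one is then
    [rho_s12 = 0], that is [f = 2 s b], and the fourth is the formula for
    [mu].  If [Delta] vanished, so would
    [rho_s]. *)
Lemma normal_form_of_solution M mu s f x y :
  rho_s_nonzero M -> (s = 1 \/ s = -1) ->
  coef M I2 I2 I1 = s -> coef M I1 I2 I1 = 0 -> mu <> 0 ->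
  E mu (conn M) f -> 0 < x -> f x y <> 0 -> normal_form s mu M.
Proof.
  intros Hr Hs He Hc H0 HE Hx Hf.
  destruct (translation_invariant_jet mu M f x y HE Hx Hf)
    as (v0 & v1 & Hv & Q1 & Q2 & Q3 & Q4).
  pose proof (sign_square s Hs) as Hss.
  assert (Hs0 : s <> 0) by (intros ->; lra).
  unfold normal_form, DeltaB, rho_s_nonzero, ric_s, ric in *; rewrite He, Hc in *.
  set (a := coef M I1 I1 I1) in *; set (b := coef M I1 I1 I2) in *.
  set (d := coef M I1 I2 I2) in *; set (g := coef M I2 I2 I2) in *.
  assert (V1 : v1 = mu * (- a + d + 1) * v0).
  { apply (Rmult_eq_reg_l s); [|exact Hs0]. lra. }
  assert (V0 : v0 <> 0).
  { intros Z; destruct Hv as [Hv|Hv]; apply Hv; [exact Z|]. rewrite V1, Z; ring. }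
  assert (Hg : g = s * 2 * b).
  { apply (Rmult_eq_reg_l (mu * v0)); [lra|].
    now apply Rmult_integral_contrapositive_currified. }
  assert (K : mu * (- a + d + 1) ^ 2 = d * (1 + a - d) + s * 2 * b ^ 2 + (1 + a) * (- a + d + 1)).
  { apply (Rmult_eq_reg_l (mu * v0 * s)).
    - rewrite V1, Hg in Q4. lra.
    - now repeat apply Rmult_integral_contrapositive_currified. }
  assert (D0 : - a + d + 1 <> 0).
  { intros Z; apply Hr. rewrite Z in K. rewrite Hg.
    repeat split; try lra.
    replace (a - d - 1) with (- (- a + d + 1)) by ring. rewrite Z; field. }
  repeat split; auto.
  apply (Rmult_eq_reg_r ((- a + d + 1) ^ 2)); [|now apply pow_nonzero].
  rewrite K; field; exact D0.
Qed.

(** The third equation says that [x^al] solves the (1,1) component of the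
    Hessian equation. *)
Lemma normal_form_ric s mu N : normal_form s mu N ->
  let al := mu * DeltaB N in
  ric_s N I1 I2 = 0
  /\ mu * ric_s N I2 I2 = - s * al
  /\ mu * ric_s N I1 I1 = al * (al - 1 - coef N I1 I1 I1).
Proof.
  intros (He & Hc & Hf & HD & Hm) al.
  unfold ric_s, ric; rewrite He, Hc, Hf.
  repeat split.
  - field.
  - unfold al, DeltaB; field.
  - assert (K : mu * DeltaB N ^ 2 = 1 + s * 2 * coef N I1 I1 I2 ^ 2
           - (coef N I1 I1 I1 - coef N I1 I2 I2) ^ 2 + 2 * coef N I1 I2 I2).
    { rewrite Hm at 1; field; exact HD. }
    transitivity (mu * (mu * DeltaB N ^ 2 - DeltaB N * (1 + coef N I1 I1 I1)));
      [rewrite K; unfold DeltaB; field | unfold al; ring].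
Qed.

(** The conditions on a normal form under which the solution
    [x^(mu Delta)] has the companion [x^(mu Delta) (y - 2 b x)], where
    [b = C_11^2]: the first is the (1,2) component of the Hessian equation,
    the second its (1,1) component.  The (2,2) component alone dictates the
    slope [2 b]. *)
Definition second_solution (mu : R) (N : typeB) : Prop :=
  coef N I1 I2 I2 = mu * DeltaB N
  /\ coef N I1 I1 I2 * (1 - 2 * coef N I1 I1 I1 + 4 * coef N I1 I2 I2) = 0.

Lemma normal_form_solutions s mu N k0 k2 :
  normal_form s mu N ->
  k2 = 0 \/ second_solution mu N ->
  E mu (conn N) (powlin (mu * DeltaB N) k0 (- 2 * coef N I1 I1 I2 * k2) k2).
Proof.
  unfold second_solution; intros HN HK; pose proof HN as (He & Hc & Hf & _ & _).
  destruct (normal_form_ric s mu N HN) as (R12 & R22 & R11).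
  set (al := mu * DeltaB N) in *.
  apply E_iff; split; [apply smooth_powlin|]; intros i j x y Hx.
  assert (F1 : forall be l0 l1 l2, eq_on (pd I1 (powlin be l0 l1 l2))
    (powlin (be - 1) (be * l0) ((be + 1) * l1) (be * l2))).
  { intros be l0 l1 l2 u v Hu; now apply is_derive_unique, is_derive_powlin1. }
  assert (F2 : forall be l0 l1 l2, eq_on (pd I2 (powlin be l0 l1 l2))
    (powlin be l2 0 0)).
  { intros be l0 l1 l2 u v Hu; apply is_derive_unique, is_derive_powlin2. }
  unfold sum2; rewrite (F1 al _ _ _ x y Hx), (F2 al _ _ _ x y Hx).
  assert (P : Rpower x al = x ^ 2 * Rpower x (al - 2)).
  { rewrite Rpower_succ, (Rpower_succ x (al - 1)) by exact Hx.
    replace (al - 1 - 1) with (al - 2) by ring; ring. }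
  assert (P' : Rpower x (al - 1) = x * Rpower x (al - 2)).
  { rewrite (Rpower_succ x (al - 1)) by exact Hx.
    now replace (al - 1 - 1) with (al - 2) by ring. }
  set (b := coef N I1 I1 I2) in *; set (a := coef N I1 I1 I1) in *.
  set (d := coef N I1 I2 I2) in *.
  assert (Kd : k2 * (d - al) = 0) by (destruct HK as [-> | (-> & _)]; ring).
  assert (Kb : k2 * (b * (1 - 2 * a + 4 * al)) = 0).
  { destruct HK as [-> | (<- & Z)]; [ring|rewrite Z; ring]. }
  destruct i, j;
    rewrite ?(pd_eq_on _ _ _ (F1 al _ _ _) x y Hx), ?(pd_eq_on _ _ _ (F2 al _ _ _) x y Hx),
      ?(F1 _ _ _ _ x y Hx), ?(F2 _ _ _ _ x y Hx);
    rewrite ?(coef_sym N I2 I1); fold a b d;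
    try replace (ric_s N I2 I1) with (ric_s N I1 I2) by (unfold ric_s; field);
    rewrite ?R11, ?R12, ?R22, ?He, ?Hc, ?Hf; unfold powlin; fold b;
    replace (al - 1 - 1) with (al - 2) by ring; rewrite ?P, ?P';
    set (q := Rpower x (al - 2)).
  - apply Rminus_diag_uniq.
    transitivity (- (q * x) * (k2 * (b * (1 - 2 * a + 4 * al)))); [field; lra|].
    rewrite Kb; ring.
  - apply Rminus_diag_uniq. transitivity (- (q * x) * (k2 * (d - al))); [field; lra|].
    rewrite Kd; ring.
  - apply Rminus_diag_uniq. transitivity (- (q * x) * (k2 * (d - al))); [field; lra|].
    rewrite Kd; ring.
  - field; lra.
Qed.

(** * Solutions of a normal form *)

Lemma constant_of_zero_partials (F : sfun) :
  (forall x y, 0 < x -> is_derive (fun t => F t y) x 0) ->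
  (forall x y, 0 < x -> is_derive (fun t => F x t) y 0) ->
  forall x y, 0 < x -> F x y = F 1 0.
Proof.
  intros D1 D2 x y Hx. transitivity (F 1 y).
  - destruct (Rtotal_order x 1) as [L|[->|L]]; [|reflexivity|symmetry];
      apply (eq_is_derive (fun t => F t y)); try exact L;
      intros t Ht; apply D1; lra.
  - destruct (Rtotal_order y 0) as [L|[->|L]]; [|reflexivity|symmetry];
      apply (eq_is_derive (fun t => F 1 t)); try exact L;
      intros t Ht; apply D2; lra.
Qed.

Lemma is_derive_Rpower_mult (g : R -> R) (be x l : R) : 0 < x -> is_derive g x l ->
  is_derive (fun t => Rpower t be * g t) x (Rpower x (be - 1) * (be * g x + x * l)).
Proof.
  intros Hx Hg.
  eapply is_derive_eq.
  - apply (is_derive_mult (fun t => Rpower t be) g x (be * Rpower x (be - 1))).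
    + now apply is_derive_Reals, derivable_pt_lim_power.
    + exact Hg.
    + intros; apply Rmult_comm.
  - rewrite (Rpower_succ x be Hx); unfold plus, mult; simpl; ring.
Qed.

(** This is the last component of the commutator relation divided by
    [s (mu + 1) Delta]. *)
Lemma normal_form_jet_relation s mu N g w :
  (s = 1 \/ s = -1) -> normal_form s mu N -> mu <> -1 -> E mu (conn N) g ->
  jet_hull g w ->
  let al := mu * DeltaB N in
  let ka := coef N I1 I1 I2 / ((mu + 1) * DeltaB N) in
  snd (fst w) = al * fst (fst w) - ka * snd w.
Proof.
  intros Hs HN H1 HE Hw al ka.
  assert (H1' : mu + 1 <> 0) by (intros Z; apply H1; lra).
  pose proof (jet_hull_commutator mu N g w HE Hw) as C.
  pose proof (sign_square s Hs) as Hss.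
  assert (Hs0 : s <> 0) by (intros ->; lra).
  destruct w as [[w0 w1] w2]; simpl in C; injection C; intros C2 _ _; clear C.
  pose proof HN as (He & Hc & Hf & HD & _).
  destruct (normal_form_ric s mu N HN) as (R12 & R22 & R11); fold al in R22, R11.
  rewrite He, Hc, Hf, R12, R22, R11 in C2.
  set (b := coef N I1 I1 I2) in *; set (a := coef N I1 I1 I1) in *.
  assert (Hd : coef N I1 I2 I2 = DeltaB N + a - 1) by (unfold DeltaB, a; ring).
  rewrite Hd in C2.
  set (D := DeltaB N) in *.
  cbn [fst snd]; apply (Rmult_eq_reg_l (s * (mu + 1) * D)).
  - replace (s * (mu + 1) * D * (al * w0 - ka * w2)) with
      (s * (mu + 1) * D * al * w0 - s * b * w2)
      by (unfold ka; field; now split).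
    unfold al in *. lra.
  - now repeat apply Rmult_integral_contrapositive_currified.
Qed.

(** By the first-order relation, [jetY] multiplies the last component of the
    vectors of the hull by [la = s (2 b - ka)].  If this component is nonzero
    somewhere, nilpotency gives [la = 0], i.e.
    [ka = 2 b]; the relation applied to the images under [jetY] and [jetX]
    then gives the two conditions. *)
Lemma normal_form_jet_dichotomy s mu N g :
  (s = 1 \/ s = -1) -> normal_form s mu N -> mu <> -1 -> E mu (conn N) g ->
  let al := mu * DeltaB N in
  let b := coef N I1 I1 I2 in
  ((forall x y, 0 < x -> pd I2 g x y = 0) \/ second_solution mu N)
  /\ forall x y, 0 < x -> x * pd I1 g x y = al * g x y - 2 * b * (x * pd I2 g x y).
Proof.
  intros Hs HN H1 HE al b; unfold second_solution; fold al b.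
  set (ka := b / ((mu + 1) * DeltaB N)); set (la := s * (2 * b - ka)).
  assert (Rel : forall w, jet_hull g w -> snd (fst w) = al * fst (fst w) - ka * snd w).
  { intros w; exact (normal_form_jet_relation s mu N g w Hs HN H1 HE). }
  pose proof (sign_square s Hs) as Hss.
  pose proof HN as (He & Hc & Hf & HD & _).
  destruct (normal_form_ric s mu N HN) as (R12 & R22 & R11); fold al in R22, R11.
  fold b in Hf.
  assert (HY : forall w, jet_hull g w -> snd (jetY mu N w) = la * snd w).
  { intros [[w0 w1] w2] Hw; pose proof (Rel _ Hw) as Rw; simpl in *.
    rewrite R22, He, Hf, Rw; unfold la; ring. }
  assert (P0 : forall x y, 0 < x ->
    x * pd I1 g x y = al * g x y - ka * (x * pd I2 g x y)).
  { intros x y Hx; exact (Rel _ (jet_hull_jet g x y Hx)). }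
  destruct (classic (forall x y, 0 < x -> pd I2 g x y = 0)) as [Z|NZ].
  { split; [now left|]. intros x y Hx; rewrite P0, Z by exact Hx; ring. }
  apply not_all_ex_not in NZ; destruct NZ as (x & NZ).
  apply not_all_ex_not in NZ; destruct NZ as (y & NZ).
  apply imply_to_and in NZ; destruct NZ as (Hx & NZ).
  assert (W2 : snd (jet g x y) <> 0)
    by (apply Rmult_integral_contrapositive_currified; [lra | exact NZ]).
  pose proof (jet_hull_jet g x y Hx) as Hw.
  revert Hw W2; generalize (jet g x y); intros w Hw W2.
  pose proof (jet_hull_jetY mu N g _ HE Hw) as HwY.
  pose proof (jet_hull_jetY mu N g _ HE HwY) as HwYY.
  assert (La : la = 0).
  { pose proof (HY _ HwYY) as K.
    rewrite (jetY_nilpotent mu N g w HE Hw), (HY _ HwY), (HY _ Hw) in K.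
    simpl in K; symmetry in K.
    apply Rmult_integral in K; destruct K as [K|K]; [exact K|].
    apply Rmult_integral in K; destruct K as [K|K]; [exact K|].
    apply Rmult_integral in K; destruct K as [K|K]; [exact K|contradiction]. }
  assert (Ka : ka = 2 * b).
  { assert (s * la = 2 * b - ka) by (unfold la; rewrite <- Rmult_assoc, Hss; ring).
    rewrite La in *; lra. }
  split; [right|now rewrite <- Ka].
  pose proof (Rel _ Hw) as Rw.
  pose proof (Rel _ HwY) as RY; rewrite (HY _ Hw), La in RY.
  pose proof (Rel _ (jet_hull_jetX mu N g _ HE Hw)) as RX.
  rewrite Ka in *; clear - R11 R12 Hc Rw RY RX W2.
  destruct w as [[w0 w1] w2]; simpl in *.
  rewrite R12, Hc in *; rewrite R11 in RX; fold b in RX.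
  assert (Hd : coef N I1 I2 I2 = al) by (apply (Rmult_eq_reg_r w2); lra).
  split; [exact Hd|].
  apply (Rmult_eq_reg_r w2); [|exact W2].
  rewrite Rw, Hd in *. lra.
Qed.

(** The functions [k2 = x^(-al) g_2] and [x^(-al) g - k2 (y - 2 b x)] have
    vanishing partial derivatives. *)
Lemma normal_form_structure s mu N g :
  (s = 1 \/ s = -1) -> normal_form s mu N -> mu <> -1 -> E mu (conn N) g ->
  exists k0 k2,
    eq_on g (powlin (mu * DeltaB N) k0 (- 2 * coef N I1 I1 I2 * k2) k2)
    /\ (k2 = 0 \/ second_solution mu N).
Proof.
  intros Hs HN H1 HE.
  destruct (normal_form_jet_dichotomy s mu N g Hs HN H1 HE) as (Di & P1).
  unfold second_solution in *.
  destruct (normal_form_ric s mu N HN) as (R12 & R22 & R11).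
  pose proof HN as (He & Hc & Hf & HD & _).
  set (al := mu * DeltaB N) in *; set (b := coef N I1 I1 I2) in *.
  pose proof HE as HE'; apply E_iff in HE'; destruct HE' as (Sg & H).
  assert (Kd : forall x y, 0 < x -> (coef N I1 I2 I2 - al) * pd I2 g x y = 0).
  { intros x y Hx; destruct Di as [Z|(-> & _)]; [rewrite Z by exact Hx|]; ring. }
  (* The coefficient of [y]: it is read off at [(1, 0)] once known to be constant. *)
  set (F := fun x y => Rpower x (- al) * pd I2 g x y).
  set (k2 := F 1 0).
  assert (F2 : forall x y, 0 < x -> F x y = k2).
  { apply constant_of_zero_partials; intros x y Hx.
    - eapply is_derive_eq.
      + apply is_derive_Rpower_mult; [exact Hx|].
        apply smooth_is_derive1; [now apply smooth_pd | exact Hx].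
      + rewrite H by exact Hx; unfold sum2; rewrite Hc, R12.
        transitivity (Rpower x (- al - 1) * ((coef N I1 I2 I2 - al) * pd I2 g x y));
          [field; lra | rewrite Kd by exact Hx; ring].
    - eapply is_derive_eq.
      + apply (is_derive_scal (fun t => pd I2 g x t)).
        apply smooth_is_derive2; [now apply smooth_pd | exact Hx].
      + rewrite H by exact Hx; unfold sum2; rewrite He, Hf, R22.
        transitivity (Rpower x (- al) * (s * (x * pd I1 g x y) + s * 2 * b * (x * pd I2 g x y)
          - s * al * g x y) / x ^ 2); [field; lra|].
        rewrite P1 by exact Hx; field; lra. }
  set (G := fun x y => Rpower x (- al) * g x y + k2 * (2 * b * x - y)).
  set (k0 := G 1 0).
  assert (G0 : forall x y, 0 < x -> G x y = k0).
  { apply constant_of_zero_partials; intros x y Hx.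
    - eapply is_derive_eq.
      + eapply (is_derive_plus (fun t => Rpower t (- al) * g t y)
          (fun t => k2 * (2 * b * t - y))).
        * apply is_derive_Rpower_mult; [exact Hx|now apply smooth_is_derive1].
        * apply (is_derive_eq _ _ (k2 * (2 * b - 0)));
          [auto_derive; [easy|ring]|reflexivity].
      + rewrite P1 by exact Hx; rewrite <- (F2 x y Hx); unfold F, plus; simpl.
        rewrite (Rpower_succ x (- al) Hx); ring.
    - eapply is_derive_eq.
      + eapply (is_derive_plus (fun t => Rpower x (- al) * g x t)
          (fun t => k2 * (2 * b * x - t))).
        * apply (is_derive_scal (fun t => g x t)). now apply smooth_is_derive2.
        * apply (is_derive_eq _ _ (- k2));
          [auto_derive; [easy|ring]|reflexivity].
      + rewrite <- (F2 x y Hx); unfold F, plus; simpl; ring. }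
  exists k0, k2; split.
  - intros x y Hx; unfold powlin.
    rewrite <- (G0 x y Hx); unfold G.
    replace (Rpower x (- al) * g x y + k2 * (2 * b * x - y) + - 2 * b * k2 * x + k2 * y)
      with (Rpower x (- al) * g x y) by ring.
    rewrite <- Rmult_assoc, <- Rpower_plus.
    replace (al + - al) with 0 by ring. rewrite Rpower_O by exact Hx; ring.
  - destruct Di as [Z|Di]; [left | now right].
    unfold k2, F; rewrite Z by lra; ring.
Qed.

Lemma smul_span_pair g h1 h2 f :
  smul_span g [h1; h2] f <->
  exists k1 k2, eq_on f (fun x y => g x y * (k1 * h1 x y + k2 * h2 x y)).
Proof.
  split.
  - intros ([|k1 [|k2 [|]]] & L & H); try discriminate L.
    exists k1, k2; intros x y Hx; rewrite (H x y Hx); simpl; ring.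
  - intros (k1 & k2 & H); exists [k1; k2]; split; [reflexivity|].
    intros x y Hx; rewrite (H x y Hx); simpl; ring.
Qed.

Lemma E_eq_on mu M f g : eq_on f g -> E mu (conn M) f -> E mu (conn M) g.
Proof.
  intros H HE; apply E_iff in HE; apply E_iff; destruct HE as (Hs & HE); split.
  - now apply smooth_eq_on with f.
  - intros i j x y Hx.
    assert (P : forall k, eq_on (pd k f) (pd k g)) by (intros k; now apply pd_eq_on).
    rewrite <- (pd_eq_on i _ _ (P j) x y Hx), HE by exact Hx.
    unfold sum2; now rewrite !P, H by exact Hx.
Qed.

Lemma normal_form_E s mu N :
  (s = 1 \/ s = -1) -> normal_form s mu N -> mu <> -1 -> second_solution mu N ->
  forall f, E mu (conn N) f <->
    smul_span (fun x _ => Rpower x (mu * DeltaB N))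
      [fun _ _ => 1; fun x y => y - 2 * coef N I1 I1 I2 * x] f.
Proof.
  intros Hs HN H1 H2 f; rewrite smul_span_pair; split.
  - intros HE; destruct (normal_form_structure s mu N f Hs HN H1 HE) as (k0 & k2 & Ef & _).
    exists k0, k2; intros x y Hx; rewrite (Ef x y Hx); unfold powlin; ring.
  - intros (k0 & k2 & Ef).
    apply E_eq_on with (2 := normal_form_solutions s mu N k0 k2 HN (or_intror H2)).
    intros x y Hx; rewrite (Ef x y Hx); unfold powlin; ring.
Qed.

Lemma Rpower_neq_0 x al : Rpower x al <> 0.
Proof. apply Rgt_not_eq, exp_pos. Qed.

(** Two solutions without a term in [y] are proportional to [x^(mu Delta)], so a
    basis contains one with [k2 <> 0]. *)
Lemma normal_form_dim_2 s mu N :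
  (s = 1 \/ s = -1) -> normal_form s mu N -> mu <> -1 ->
  (dim_eq (E mu (conn N)) 2 <-> second_solution mu N).
Proof.
  intros Hs HN H1; split.
  - intros ([|f1 [|f2 [|]]] & L & F & I & _); try discriminate L.
    inversion F as [|? ? HE1 F']; subst; inversion F' as [|? ? HE2 _]; subst.
    destruct (normal_form_structure s mu N f1 Hs HN H1 HE1) as (p0 & p2 & E1 & [Z1|S]);
      [|exact S].
    destruct (normal_form_structure s mu N f2 Hs HN H1 HE2) as (q0 & q2 & E2 & [Z2|S]);
      [|exact S].
    exfalso; subst p2 q2.
    assert (Q : List.Forall (fun k => k = 0) [q0; - p0]).
    { apply I; [reflexivity|]; intros x y Hx; simpl.
      rewrite (E1 x y Hx), (E2 x y Hx); unfold powlin; ring. }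
    assert (Hp0 : p0 = 0).
    { inversion Q as [|? ? _ Q']; inversion Q'; lra. }
    assert (Q1 : List.Forall (fun k => k = 0) [1; 0]).
    { apply I; [reflexivity|]; intros x y Hx; simpl.
      rewrite (E1 x y Hx), Hp0; unfold powlin; ring. }
    inversion Q1; lra.
  - intros S; pose proof (normal_form_E s mu N Hs HN H1 S) as HE.
    set (al := mu * DeltaB N) in *; set (b := coef N I1 I1 I2) in *.
    exists [fun x _ => Rpower x al * 1; fun x y => Rpower x al * (y - 2 * b * x)].
    split; [reflexivity|split; [|split]].
    + apply List.Forall_cons; [|apply List.Forall_cons; [|apply List.Forall_nil]];
        apply HE, smul_span_pair; [exists 1, 0 | exists 0, 1]; intros x y Hx; ring.
    + intros [|k1 [|k2 [|]]] L Z; try discriminate L.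
      assert (K : forall x y, 0 < x -> k1 + k2 * (y - 2 * b * x) = 0).
      { intros x y Hx; apply (Rmult_eq_reg_l (Rpower x al)); [|apply Rpower_neq_0].
        rewrite Rmult_0_r, <- (Z x y Hx); simpl; ring. }
      pose proof (K 1 (2 * b) Rlt_0_1) as K1.
      pose proof (K 1 (2 * b + 1) Rlt_0_1) as K2.
      repeat constructor; lra.
    + intros f Hf; exact (proj1 (HE f) Hf).
Qed.

(** Multiplying [d = mu Delta] by [Delta] eliminates [mu] from the normal
    form and leaves a polynomial equation in [a, b, d]. *)
Lemma second_solution_families s mu N :
  (s = 1 \/ s = -1) -> normal_form s mu N -> mu <> 0 -> mu <> -1 ->
  second_solution mu N ->
  family1 s (coef N I1 I1 I2) N \/ family2 s (coef N I1 I1 I1) N.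
Proof.
  intros Hs (He & Hc & Hf & HD & Hm) H0 H1 (S1 & S2).
  assert (K : coef N I1 I2 I2 * DeltaB N = 1 + s * 2 * coef N I1 I1 I2 ^ 2
      - (coef N I1 I1 I1 - coef N I1 I2 I2) ^ 2 + 2 * coef N I1 I2 I2).
  { rewrite S1 at 1; rewrite Hm at 1; field; exact HD. }
  unfold family1, family2, DeltaB in *.
  set (a := coef N I1 I1 I1) in *; set (b := coef N I1 I1 I2) in *.
  set (d := coef N I1 I2 I2) in *.
  destruct (Req_dec b 0) as [Hb|Hb].
  - right. rewrite Hb in *.
    assert (P : (d - a - 1) * (2 * d + 1 - a) = 0) by lra.
    apply Rmult_integral in P; destruct P as [P|P].
    + assert (Hd : d = a + 1) by lra; rewrite Hd in *.
      repeat split; auto; try lra; intros Z; rewrite Z in *; lra.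
    + exfalso. assert (Ha : a = 2 * d + 1) by lra; rewrite Ha in *.
      apply H1, (Rmult_eq_reg_r d); lra.
  - left. apply Rmult_integral in S2; destruct S2 as [S2|S2]; [contradiction|].
    assert (Ha : a = 2 * d + / 2) by lra; rewrite Ha in *.
    repeat split; auto; lra.
Qed.

Lemma family1_second_solution s c mu P :
  (s = 1 \/ s = -1) -> family1 s c P -> normal_form s mu P -> second_solution mu P.
Proof.
  intros Hs (Ha & Hb & _ & Hd & _) (_ & _ & _ & HD & Hm).
  split; [|rewrite Ha, Hb, Hd; field].
  apply (Rmult_eq_reg_r (DeltaB P)); [|exact HD].
  transitivity (mu * DeltaB P ^ 2); [|ring].
  rewrite Hm. field_simplify; [|exact HD].
  unfold DeltaB; rewrite Ha, Hb, Hd; field_simplify.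
  destruct Hs as [-> | ->]; field.
Qed.

Lemma family2_second_solution s c mu P :
  family2 s c P -> normal_form s mu P -> second_solution mu P.
Proof.
  intros (Ha & Hb & _ & Hd & _) (_ & _ & _ & HD & Hm).
  split; [|rewrite Hb; ring].
  apply (Rmult_eq_reg_r (DeltaB P)); [|exact HD].
  transitivity (mu * DeltaB P ^ 2); [|ring].
  rewrite Hm. field_simplify; [|exact HD].
  unfold DeltaB; rewrite Ha, Hb, Hd; field.
Qed.

(** The equivalence between two such models preserves [e = s] and [c = 0], so
    it is [y |-> A x + B y] with [B = t], [t^2 = 1], and [A = 0]; it therefore
    multiplies [b] by [t] and fixes [a] and [d].  Both models are compared
    through [M], whence the two pairs [(A, B)] and [(t A, t B)]. *)
Lemma normal_form_transport s mu M N P :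
  (s = 1 \/ s = -1) -> lin_equiv M N -> lin_equiv M P -> normal_form s mu N ->
  coef P I2 I2 I1 = s -> coef P I1 I2 I1 = 0 ->
  coef P I2 I2 I2 = s * 2 * coef P I1 I1 I2 -> normal_form s mu P.
Proof.
  intros Hs HN HP (He & Hc & Hf & HD & Hm) He' Hc' Hf'.
  pose proof (sign_square s Hs) as Hss.
  assert (Hs0 : s <> 0) by (intros ->; lra).
  apply sheared_of_lin_equiv in HN; destruct HN as (A & B & HB & SN).
  apply sheared_of_lin_equiv in HP; destruct HP as (A' & B' & HB' & SP).
  apply sheared_solved in SN; [|exact HB]; apply sheared_solved in SP; [|exact HB'].
  destruct SN as (N1 & _ & N3 & N4 & N5 & N6).
  destruct SP as (P1 & _ & P3 & P4 & P5 & P6).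
  rewrite P1 in N1; rewrite P3 in N3; rewrite P4 in N4; rewrite P5 in N5; rewrite P6 in N6.
  rewrite He, Hc, Hf, He', Hc', Hf' in *.
  clear P1 P3 P4 P5 P6.
  assert (BB : (B' - B) * (B' + B) = 0).
  { apply (Rmult_eq_reg_l s); [lra|exact Hs0]. }
  assert (R : exists t, t * t = 1 /\ B' = t * B).
  { apply Rmult_integral in BB; destruct BB; [exists 1|exists (-1)]; split; lra. }
  destruct R as (t & Ht & EB); subst B'.
  assert (EA : A' = t * A).
  { apply (Rmult_eq_reg_l (t * B * s)).
    - transitivity (A * B * s * 1); [lra | rewrite <- Ht; ring].
    - repeat apply Rmult_integral_contrapositive_currified; try assumption.
      intros ->; lra. }
  subst A'.
  assert (Ea : coef P I1 I1 I1 = coef N I1 I1 I1).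
  { replace ((t * A) ^ 2) with (A ^ 2 * (t * t)) in N1 by ring.
    rewrite Ht in N1; lra. }
  assert (Eb : t * coef P I1 I1 I2 = coef N I1 I1 I2).
  { apply (Rmult_eq_reg_l (B * (s * 2))).
    - replace (t * B * (s * 2 * coef P I1 I1 I2 - t * A * s)) with
        (B * (s * 2) * (t * coef P I1 I1 I2) - B * A * s * (t * t)) in N6 by ring.
      rewrite Ht in N6; lra.
    - repeat apply Rmult_integral_contrapositive_currified; lra. }
  assert (Ed : coef P I1 I2 I2 = coef N I1 I2 I2).
  { rewrite <- Eb in N4.
    replace (t * A * (0 + t * A * s)) with (A * A * s * (t * t)) in N4 by ring.
    rewrite Ht in N4; lra. }
  assert (Ebb : coef P I1 I1 I2 ^ 2 = coef N I1 I1 I2 ^ 2).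
  { rewrite <- Eb. transitivity ((t * t) * coef P I1 I1 I2 ^ 2); [rewrite Ht|]; ring. }
  unfold normal_form, DeltaB in *; rewrite Ea, Ed, Ebb.
  repeat split; assumption.
Qed.

(** * The classification *)

Lemma rho_tilde_is_ric M a11 a12 a21 a22 :
  ric M I1 I1 = a11 -> ric M I1 I2 = a12 -> ric M I2 I1 = a21 -> ric M I2 I2 = a22 ->
  rho_tilde_is M a11 a12 a21 a22.
Proof.
  intros <- <- <- <-; repeat split; intros x y Hx; now apply rho_tilde_homog.
Qed.

Lemma dim_ge_1_nonzero mu M :
  dim_ge (E mu (conn M)) 1 <->
  exists f x y, E mu (conn M) f /\ 0 < x /\ f x y <> 0.
Proof.
  split.
  - intros ([|f [|]] & L & F & I); try discriminate L.
    inversion F as [|? ? HE _]; subst.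
    apply NNPP; intros NE.
    assert (Q : List.Forall (fun k => k = 0) [1]).
    { apply I; [reflexivity|]; intros x y Hx; simpl.
      destruct (Req_dec (f x y) 0) as [Z|Z]; [rewrite Z; ring|].
      exfalso; apply NE; now exists f, x, y. }
    inversion Q; lra.
  - intros (f & x & y & HE & Hx & Hf); exists [f]; repeat split; auto.
    intros [|k [|]] L Z; try discriminate L.
    specialize (Z x y Hx); simpl in Z; repeat constructor.
    apply (Rmult_eq_reg_r (f x y)); [lra|exact Hf].
Qed.

Lemma dim_eq_lin_equiv mu M N n : lin_equiv M N ->
  (dim_eq (E mu (conn M)) n <-> dim_eq (E mu (conn N)) n).
Proof.
  intros H; apply sheared_of_lin_equiv in H; destruct H as (A & B & HB & H); split.
  - apply (dim_eq_sheared (- A / B) (/ B)).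
    + now apply Rinv_neq_0_compat.
    + now apply sheared_sym.
  - now apply (dim_eq_sheared A B).
Qed.

Theorem theorem5p10 (M : typeB) (mu : R) :
  (exists i j x y, 0 < x /\ rho_s (conn M) i j x y <> 0) ->
  (coef M I1 I2 I1, coef M I2 I2 I1, coef M I2 I2 I2) <> (0, 0, 0) ->
  mu <> 0 -> mu <> - 1 ->
  (dim_ge (E mu (conn M)) 1 <->
     exists s N, (s = 1 \/ s = - 1) /\ lin_equiv M N /\ normal_form s mu N)
  /\
  (forall s N, (s = 1 \/ s = - 1) -> lin_equiv M N -> normal_form s mu N ->
     (forall f, span [fun x _ => Rpower x (mu * DeltaB N)] f ->
                E mu (conn N) f)
     /\ rho_tilde_is N
          (s * 2 * (coef N I1 I1 I2) ^ 2
           + (coef N I1 I1 I1 - coef N I1 I2 I2 + 1) * coef N I1 I2 I2)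
          (s * coef N I1 I1 I2)
          (- s * coef N I1 I1 I2)
          (s * (coef N I1 I1 I1 - coef N I1 I2 I2 - 1))
     /\ (dim_eq (E mu (conn M)) 2 <->
           (exists c P, lin_equiv M P /\ family1 s c P)
           \/ (exists c P, lin_equiv M P /\ family2 s c P))
     /\ (forall c P, lin_equiv M P -> family1 s c P ->
           mu = - ((s * 8 * c ^ 2 + 3) / (s * 8 * c ^ 2 + 4))
           /\ (forall f, E mu (conn P) f <->
                 smul_span (fun x _ => Rpower x (- s * 4 * c ^ 2 - 3 / 2))
                           [fun _ _ => 1; fun x y => y - 2 * c * x] f)
           /\ rho_tilde_is P
                (8 * (2 * c ^ 4 + s * c ^ 2)) (s * c)
                (- s * c) (- 4 * c ^ 2 - s * 2))
     /\ (forall c P, lin_equiv M P -> family2 s c P ->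
           mu = (c + 1) / 2
           /\ (forall f, E mu (conn P) f <->
                 smul_span (fun x _ => Rpower x (1 + c))
                           [fun _ _ => 1; fun _ y => y] f)
           /\ rho_tilde_is P 0 0 0 (- s * 2))).
Proof.
  intros Hrho HA H0 H1; split.
  - split.
    + intros HD; apply dim_ge_1_nonzero in HD; destruct HD as (f & x & y & HE & Hx & Hf).
      apply rho_s_nonzero_of_point in Hrho.
      destruct (Req_dec (coef M I2 I2 I1) 0) as [He|He].
      { exfalso; apply Hf.
        now apply (no_solution_when_C221_zero M mu f x y). }
      destruct (normalizing_shear M He) as (s & A & B & N & Hs & HB & S & He' & Hc').
      exists s, N; split; [exact Hs|split].
      * now apply (lin_equiv_of_sheared A B).
      * assert (HB' : / B <> 0) by now apply Rinv_neq_0_compat.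
        apply (normal_form_of_solution N mu s (shear (- A / B) (/ B) f) x (A * x + B * y));
          try assumption.
        -- now apply (rho_s_nonzero_sheared A B M N).
        -- apply (E_shear _ _ mu N M); [exact HB'| |exact HE].
           now apply sheared_sym.
        -- unfold shear; replace (- A / B * x + / B * (A * x + B * y)) with y
             by (field; exact HB); exact Hf.
    + intros (s & N & Hs & HMN & HN).
      apply sheared_of_lin_equiv in HMN; destruct HMN as (A & B & HB & S).
      apply (dim_ge_sheared A B mu M N 1 HB S), dim_ge_1_nonzero.
      eexists; exists 1, 0; split; [|split; [exact Rlt_0_1|]].
      * apply (normal_form_solutions s mu N 1 0 HN); now left.
      * unfold powlin. apply Rmult_integral_contrapositive_currified;
          [apply Rpower_neq_0|lra].
  - intros s N Hs HMN HN.
    pose proof (sign_square s Hs) as Hss.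
    assert (T1 : forall c P, lin_equiv M P -> family1 s c P -> normal_form s mu P).
    { intros c P HP (_ & Hb & Hc & _ & He & Hf & _).
      apply (normal_form_transport s mu M N P); try assumption. now rewrite Hb. }
    assert (T2 : forall c P, lin_equiv M P -> family2 s c P -> normal_form s mu P).
    { intros c P HP (_ & Hb & Hc & _ & He & Hf & _).
      apply (normal_form_transport s mu M N P); try assumption.
      rewrite Hb, Hf; ring. }
    split; [|split; [|split; [|split]]].
    + intros f ([|k [|]] & L & Ef); try discriminate L.
      apply E_eq_on with (2 := normal_form_solutions s mu N k 0 HN (or_introl eq_refl)).
      intros x y Hx; rewrite (Ef x y Hx); unfold powlin; simpl; ring.
    + destruct HN as (He & Hc & Hf & _).
      apply rho_tilde_is_ric; unfold ric; rewrite ?He, ?Hc, ?Hf; ring.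
    + rewrite (dim_eq_lin_equiv mu M N 2 HMN), (normal_form_dim_2 s mu N Hs HN H1).
      split.
      * intros S; destruct (second_solution_families s mu N Hs HN H0 H1 S) as [F|F];
          [left|right]; eexists; exists N; split; eassumption.
      * intros F.
        assert (Q : exists P, lin_equiv M P /\ normal_form s mu P /\ second_solution mu P).
        { destruct F as [(c & P & HP & F)|(c & P & HP & F)]; exists P; split;
            try exact HP.
          - pose proof (T1 c P HP F) as HNP; split; [exact HNP|].
            now apply (family1_second_solution s c).
          - pose proof (T2 c P HP F) as HNP; split; [exact HNP|].
            now apply (family2_second_solution s c). }
        destruct Q as (P & HP & HNP & S).
        apply (normal_form_dim_2 s mu N Hs HN H1), (dim_eq_lin_equiv mu M N 2 HMN),
          (dim_eq_lin_equiv mu M P 2 HP), (normal_form_dim_2 s mu P Hs HNP H1), S.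
    + intros c P HP F; pose proof (T1 c P HP F) as HNP.
      pose proof (family1_second_solution s c mu P Hs F HNP) as S.
      pose proof (normal_form_E s mu P Hs HNP H1 S) as HE.
      destruct F as (Ha & Hb & Hc & Hd & He & Hf & _).
      destruct S as (Hal & _).
      rewrite <- Hal in HE.
      assert (HD : DeltaB P = s * 4 * c ^ 2 + 2)
        by (unfold DeltaB; rewrite Ha, Hd; field).
      assert (HD0 : s * 4 * c ^ 2 + 2 <> 0) by (rewrite <- HD; apply HNP).
      split; [|split].
      * apply (Rmult_eq_reg_r (DeltaB P)); [|rewrite HD; exact HD0].
        rewrite <- Hal, Hd, HD; field; lra.
      * rewrite Hb in HE. rewrite Hd in HE.
        replace (- s * 4 * c ^ 2 - 3 / 2) with (/ 2 * (- s * 8 * c ^ 2 - 3)) by field.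
        exact HE.
      * apply rho_tilde_is_ric; unfold ric; rewrite ?Ha, ?Hb, ?Hc, ?Hd, ?He, ?Hf;
          destruct Hs as [-> | ->]; field.
    + intros c P HP F; pose proof (T2 c P HP F) as HNP.
      pose proof (family2_second_solution s c mu P F HNP) as S.
      pose proof (normal_form_E s mu P Hs HNP H1 S) as HE.
      destruct F as (Ha & Hb & Hc & Hd & He & Hf & _).
      destruct S as (Hal & _).
      rewrite <- Hal in HE.
      assert (HD : DeltaB P = 2) by (unfold DeltaB; rewrite Ha, Hd; ring).
      split; [|split].
      * rewrite HD, Hd in Hal; lra.
      * intros f; rewrite HE, Hd, Hb, !smul_span_pair.
        replace (c + 1) with (1 + c) by ring.
        split; intros (k1 & k2 & K); exists k1, k2; intros x y Hx;
          rewrite (K x y Hx); ring.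
      * apply rho_tilde_is_ric; unfold ric; rewrite ?Ha, ?Hb, ?Hc, ?Hd, ?He, ?Hf; ring.
Qed.
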